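(* Let $\Omega\subset\mathbb R^2$ be a compact convex set with non-empty interior. Then $$\bigl|c(\partial\Omega)-c(\Omega)\bigr|\le \frac16\, d(\Omega)\le\frac1{12}\,\mathrm{length}(\partial\Omega).$$
   Context: $c(\Omega)$ denotes the center of mass of $\Omega$ with respect to area (Lebesgue measure), and $c(\partial\Omega)$ denotes the center of mass of the boundary curve $\partial\Omega$ with respect to arc length (one-dimensional Hausdorff measure). $d(\Omega)$ is the diameter of $\Omega$, $\mathrm{length}(\partial\Omega)$ is the perimeter of $\Omega$ (the length of its boundary curve), and $|\cdot|$ is the Euclidean norm. *)

(* Defs.v *)
From HB Require Import structures.
From mathcomp Require Import all_boot all_order all_algebra.
From mathcomp Require Import all_classical all_reals all_analysis.

Set Implicit Arguments.
Unset Strict Implicit.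
Unset Printing Implicit Defensive.
Import Order.TTheory GRing.Theory Num.Theory.
Import numFieldNormedType.Exports.
Local Open Scope classical_set_scope.
Local Open Scope ring_scope.

(* The Euclidean plane as a topological R-module. Its topology is the product
   topology, but its library norm is the max norm, hence [enorm] below. *)
Notation plane R := (R^o * R^o)%type.

(* The same carrier with its Borel sigma-algebra. *)
Notation mplane R := (measurableTypeR R * measurableTypeR R)%type.

Section Plane.
Variable R : realType.
Implicit Types (x y : plane R) (A : set (plane R)).

Definition enorm x : R := Num.sqrt (x.1 ^+ 2 + x.2 ^+ 2).

(* 0 is added so that the empty set has diameter 0 rather than -oo; it changes
   nothing for nonempty sets, as one may take x = y. *)
Definition ediameter A : \bar R :=
  ereal_sup (0%E |` [set (enorm (x - y))%:E | x in A & y in A]).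

Definition diameter A : R := fine (ediameter A).

Definition boundary A : set (plane R) := closure A `\` A°.

Definition area : set (mplane R) -> \bar R :=
  (lebesgue_measure \x lebesgue_measure)%E.

Definition hausdorff1_delta (delta : R) A : \bar R :=
  ereal_inf [set (\sum_(i <oo) ediameter (U i))%E |
    U in [set U : nat -> set (plane R) |
      A `<=` \bigcup_i U i /\ forall i, (ediameter (U i) <= delta%:E)%E]].

(* The one-dimensional Hausdorff (outer) measure, normalized so that the
   measure of a line segment is its length. *)
Definition hausdorff1 A : \bar R :=
  ereal_sup [set hausdorff1_delta delta A | delta in [set delta : R | 0 < delta]].

Definition perimeter A : R := fine (hausdorff1 (boundary A)).

(* The library integral accepts any set function; integrands being Borel, only
   the values of mu on Borel subsets of A matter when A is Borel, and there both
   [area] and [hausdorff1] are measures. *)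
Definition center_of_mass (mu : set (mplane R) -> \bar R) (A : set (mplane R)) :
    plane R :=
  ((fine (mu A))^-1 * fine (\int[mu]_(x in A) (x.1 : R)%:E)%E,
   (fine (mu A))^-1 * fine (\int[mu]_(x in A) (x.2 : R)%:E)%E).

End Plane.

(* Main.v *)
Require Import Defs.
From HB Require Import structures.
From mathcomp Require Import all_boot all_order all_algebra.
From mathcomp Require Import all_classical all_reals all_analysis.
From mathcomp Require Import measurable_realfun.
From mathcomp Require Import ring lra.
Set Implicit Arguments.
Unset Strict Implicit.
Unset Printing Implicit Defensive.
Import Order.TTheory GRing.Theory Num.Theory.
Import numFieldNormedType.Exports.
Local Open Scope classical_set_scope.
Local Open Scope ring_scope.

(** A rotation makes any given direction horizontal, so that it is enough to bound
    the difference of the first coordinates of the two centers by [(b - a) / 6],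
    where [[a, b]] is the projection of the body to the first axis; [b - a] is at
    most the diameter. The body is the region between the graphs of a convex
    function [al] and a concave function [be] over [[a, b]]
    ([convex_body_region]), and its boundary consists of the two graphs and of two
    vertical segments. The center of area only depends on the lengths
    [be x - al x] of the vertical sections. By a layer-cake formula, the first moment
    of the boundary is determined by the lengths of its parts on the left of the
    vertical lines.

    The difficulty is that the length of a graph is not easily compared with the
    area. It is removed by an averaging in the spirit of Crofton: up to any relative
    error, the Euclidean norm is a finite sum of seminorms
    [v |-> `|p * v.1 + q * v.2|] with [0 < q] ([zonogon_norm]), so that the length
    may be replaced by the total variation, along the boundary, of a single linear
    functional ([hausdorff1_graph_ge], [hausdorff1_graph_le]). For one functional,
    of width [W] on the body, the variation of the boundary on the left of [x] is
    [W - eta x + gam x], where [eta] is convex and decreases to 0, [gam] is convex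
    and increases from 0, and [W - eta x - gam x] is [q] times the length of the
    vertical section. The inequality between the centers is then a statement on the
    first moments of such a pair of convex functions ([convex_pair_moment_le]);
    after elementary bounds for these moments, a square remains. The constant is
    that of a thin triangle, for which [c(Omega)] is at two thirds of the height
    and [c(boundary Omega)] tends to the middle.

    To compute with the Hausdorff measure of dimension one, it is shown to be
    additive on Borel sets, by Caratheodory's criterion for half-planes, and to be
    bounded from above on sets that expand into an interval and from below by the
    length of 1-Lipschitz images. The second inequality follows from the last
    property: after a rotation that makes a given chord horizontal, the two graphs
    both project onto an interval that contains the projection of the chord. *)

(** * The Euclidean norm and the diameter *)

Section Enorm.
Variable R : realType.
Implicit Types (x y u : plane R) (A B : set (plane R)).

Lemma enorm_ge0 x : 0 <= enorm x.
Proof. exact: sqrtr_ge0. Qed.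

Lemma sqr_enorm x : enorm x ^+ 2 = x.1 ^+ 2 + x.2 ^+ 2.
Proof. by rewrite sqr_sqrtr// addr_ge0// sqr_ge0. Qed.

Lemma enorm_le x (r : R) :
  0 <= r -> (enorm x <= r) = (x.1 ^+ 2 + x.2 ^+ 2 <= r ^+ 2).
Proof. by move=> r0; rewrite -sqr_enorm ler_pXn2r// nnegrE enorm_ge0. Qed.

Lemma enorm_ge x (r : R) : r ^+ 2 <= x.1 ^+ 2 + x.2 ^+ 2 -> r <= enorm x.
Proof.
case: (leP 0 r) => r0 h; last exact: le_trans (ltW r0) (enorm_ge0 _).
by rewrite -(@ler_pXn2r _ 2)// ?nnegrE ?enorm_ge0// sqr_enorm.
Qed.

Lemma ler_enorm_dot u x : u.1 ^+ 2 + u.2 ^+ 2 = 1 ->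
  `|u.1 * x.1 + u.2 * x.2| <= enorm x.
Proof.
move=> u1; apply: enorm_ge; rewrite real_normK ?num_real//.
have -> : x.1 ^+ 2 + x.2 ^+ 2 = (u.1 * x.1 + u.2 * x.2) ^+ 2
  + (u.1 * x.2 - u.2 * x.1) ^+ 2.
  by rewrite -[LHS]mul1r -u1; ring.
by rewrite lerDl sqr_ge0.
Qed.

Lemma ler_fst_enorm x : `|x.1| <= enorm x.
Proof.
apply: enorm_ge; rewrite real_normK ?num_real// lerDl; exact: sqr_ge0.
Qed.

Lemma ler_snd_enorm x : `|x.2| <= enorm x.
Proof.
apply: enorm_ge; rewrite real_normK ?num_real// lerDr; exact: sqr_ge0.
Qed.

End Enorm.

Section Diameter.
Variable R : realType.
Implicit Types (x y : plane R) (A B : set (plane R)).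
Local Open Scope ereal_scope.

Lemma ediameter_ge0 A : 0 <= ediameter A.
Proof. by apply: ereal_sup_ubound; left. Qed.

Lemma ediameter_le A (r : \bar R) : 0 <= r ->
  (forall x y, A x -> A y -> (enorm (x - y))%:E <= r) -> ediameter A <= r.
Proof.
move=> r0 Ar; apply: ge_ereal_sup => _ [->//|[x Ax [y Ay <-]]]; exact: Ar.
Qed.

Lemma enorm_le_ediameter A x y : A x -> A y ->
  (enorm (x - y))%:E <= ediameter A.
Proof. by move=> Ax Ay; apply: ereal_sup_ubound; right; exists x => //; exists y. Qed.

Lemma ediameter0 : ediameter (set0 : set (plane R)) = 0.
Proof. by apply/eqP; rewrite eq_le ediameter_ge0 andbT; apply: ediameter_le. Qed.

Lemma le_ediameter A B : A `<=` B -> ediameter A <= ediameter B.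
Proof.
move=> AB; apply: ediameter_le; first exact: ediameter_ge0.
by move=> x y /AB Bx /AB By; apply: enorm_le_ediameter.
Qed.

End Diameter.

(** * The one-dimensional Hausdorff measure *)

(** The plane with all of its subsets measurable: on it the outer measure generated
    by a set function is an infimum over arbitrary countable covers. *)
Definition discrete_plane (R : realType) : Type := plane R.

Section DiscretePlane.
Variable R : realType.
HB.instance Definition _ := Pointed.copy (discrete_plane R) (plane R).
HB.instance Definition _ := @isMeasurable.Build default_measure_display
  (discrete_plane R) (@discrete_measurable (plane R))
  (@discrete_measurable0 _) (@discrete_measurableC _) (@discrete_measurableU _).
End DiscretePlane.

Section Hausdorff.
Variable R : realType.
Implicit Types (x y : plane R) (A B X : set (plane R)).
Local Open Scope ereal_scope.

Let gauge (delta : R) (U : set (discrete_plane R)) : \bar R :=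
  if ediameter (U : set (plane R)) <= delta%:E then ediameter (U : set (plane R))
  else +oo.

Let gauge_ge0 delta U : 0 <= gauge delta U.
Proof. by rewrite /gauge; case: ifP => // _; exact: ediameter_ge0. Qed.

(** Giving the cost +oo to sets of large diameter turns the restriction on the
    admissible covers into a property of the gauge. *)
Let hausdorff1_deltaE delta A :
  hausdorff1_delta delta A = mu_ext (gauge delta) (A : set (discrete_plane R)).
Proof.
apply/eqP; rewrite eq_le; apply/andP; split; apply: le_ereal_inf_tmp => _ [U [U1 U2] <-].
- have [Ud|/existsNP[i /negP Ui]] :=
      pselect (forall i, ediameter (U i : set (plane R)) <= delta%:E).
    rewrite (eq_eseriesr (g := fun i => ediameter (U i : set (plane R)))).
      by apply: ereal_inf_lbound; exists U.
    by move=> i _; rewrite /gauge Ud.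
  rewrite (eseries_pinfty (k := i)) ?leey//.
    by move=> n _; rewrite -ltNye (lt_le_trans _ (gauge_ge0 _ _)).
  by rewrite /gauge (negbTE Ui).
- apply: ereal_inf_lbound; exists U; first by split.
  by apply: eq_eseriesr => i _; rewrite /gauge U2.
Qed.

Lemma hausdorff1_delta_ge0 delta A : 0 <= hausdorff1_delta delta A.
Proof. by rewrite hausdorff1_deltaE; exact: mu_ext_ge0. Qed.

Lemma hausdorff1_ge0 A : 0 <= hausdorff1 A.
Proof.
apply: le_trans (hausdorff1_delta_ge0 1%R A) _.
by apply: ereal_sup_ubound; exists 1%R => //=; exact: ltr01.
Qed.

Lemma hausdorff1_deltaS delta A B : A `<=` B ->
  hausdorff1_delta delta A <= hausdorff1_delta delta B.
Proof. by move=> AB; rewrite !hausdorff1_deltaE; exact: le_mu_ext. Qed.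

Lemma hausdorff1S A B : A `<=` B -> hausdorff1 A <= hausdorff1 B.
Proof.
move=> AB; apply: ge_ereal_sup => _ [d /= d0 <-].
apply: le_trans (hausdorff1_deltaS d AB) _.
by apply: ereal_sup_ubound; exists d.
Qed.

Lemma hausdorff1_le A (r : \bar R) :
  (forall delta : R, (0 < delta)%R -> hausdorff1_delta delta A <= r) ->
  hausdorff1 A <= r.
Proof. by move=> h; apply: ge_ereal_sup => _ [d /= d0 <-]; exact: h. Qed.

Lemma hausdorff1_delta_le A delta : (0 < delta)%R ->
  hausdorff1_delta delta A <= hausdorff1 A.
Proof. by move=> d0; apply: ereal_sup_ubound; exists delta. Qed.

Lemma hausdorff1_set0 : hausdorff1 (set0 : set (plane R)) = 0.
Proof.
apply/eqP; rewrite eq_le hausdorff1_ge0 andbT; apply: hausdorff1_le => d d0.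
rewrite hausdorff1_deltaE mu_ext0// /gauge ifT ediameter0//.
by rewrite lee_fin ltW.
Qed.

Lemma hausdorff1_sigma_subadditive : sigma_subadditive (@hausdorff1 R).
Proof.
move=> F; apply: hausdorff1_le => d d0; rewrite hausdorff1_deltaE.
apply: le_trans (mu_ext_sigma_subadditive (gauge_ge0 d) F) _.
apply: lee_nneseries => [i _ _|i _]; first exact: mu_ext_ge0.
by rewrite -hausdorff1_deltaE; exact: hausdorff1_delta_le.
Qed.

HB.instance Definition _ := isOuterMeasure.Build R (plane R) (@hausdorff1 R)
  hausdorff1_set0 hausdorff1_ge0 hausdorff1S hausdorff1_sigma_subadditive.

(** Sets of diameter smaller than the gap between [A] and [B] meet at most one of
    them, so that a fine cover of the union splits into a cover of each. *)
Lemma hausdorff1_metric A B (eta : R) : (0 < eta)%R ->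
  (forall x y, A x -> B y -> (eta <= enorm (x - y))%R) ->
  hausdorff1 A + hausdorff1 B <= hausdorff1 (A `|` B).
Proof.
move=> eta0 AB.
have key d : (0 < d < eta)%R ->
    hausdorff1_delta d A + hausdorff1_delta d B <= hausdorff1_delta d (A `|` B).
  move=> /andP[d0 deta]; apply: le_ereal_inf_tmp => _ [U [cU dU] <-].
  pose V C i := U i `&` [set _ | U i `&` C !=set0].
  have VU C i : V C i `<=` U i by exact: subIsetl.
  have V0 C i : ~ (U i `&` C !=set0) -> V C i = set0.
    by move=> UC; apply/seteqP; split => // x [].
  have cV C : C `<=` A `|` B -> C `<=` \bigcup_i V C i.
    move=> CAB x Cx; have [i _ Uix] := cU _ (CAB _ Cx).
    by exists i => //; split => //; exists x.
  have leV C : C `<=` A `|` B ->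
      hausdorff1_delta d C <= \sum_(i <oo) ediameter (V C i).
    move=> CAB; apply: ereal_inf_lbound; exists (V C) => //; split=> [|i].
      exact: cV.
    exact: le_trans (le_ediameter (VU C i)) (dU i).
  apply: le_trans (leeD (leV A (@subsetUl _ _ _)) (leV B (@subsetUr _ _ _))) _.
  rewrite -nneseriesD; [|by move=> i _ _; exact: ediameter_ge0..].
  apply: lee_nneseries => [i _ _|i _]; first by rewrite adde_ge0// ediameter_ge0.
  have [[x [Ux Ax]]|/V0 ->] := pselect (U i `&` A !=set0); last first.
    by rewrite ediameter0 add0e le_ediameter.
  have [[y [Uy By]]|/V0 ->] := pselect (U i `&` B !=set0); last first.
    by rewrite ediameter0 adde0 le_ediameter.
  have := enorm_le_ediameter Ux Uy.
  move=> /le_trans/(_ (dU i)); rewrite lee_fin => /(le_trans (AB _ _ Ax By)).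
  by move=> /le_lt_trans/(_ deta); rewrite ltxx.
have mono C d e : (0 < d <= e)%R -> hausdorff1_delta e C <= hausdorff1_delta d C.
  move=> /andP[d0 de]; apply: le_ereal_inf_tmp => _ [U [cU dU] <-].
  apply: ereal_inf_lbound; exists U => //; split => // i.
  by apply: le_trans (dU i) _; rewrite lee_fin.
have key2 d e : (0 < d)%R -> (0 < e)%R ->
    hausdorff1_delta d A + hausdorff1_delta e B <= hausdorff1 (A `|` B).
  move=> d0 e0; pose m := Num.min (Num.min d e) (eta / 2)%R.
  have m0 : (0 < m)%R by rewrite !lt_min d0 e0 divr_gt0.
  have md : (m <= d)%R by rewrite !ge_min lexx.
  have me : (m <= e)%R by rewrite !ge_min lexx orbT.
  have mh : (m < eta)%R by rewrite gt_min; apply/orP; right; lra.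
  apply: le_trans (hausdorff1_delta_le _ m0).
  apply: le_trans (key m _); last by rewrite m0.
  by apply: leeD; apply: mono; rewrite m0.
have [->|] := eqVneq (hausdorff1 (A `|` B)) +oo; first by rewrite leey.
move=> Hoo.
have fAB : hausdorff1 (A `|` B) \is a fin_num.
  by rewrite ge0_fin_numE ?hausdorff1_ge0// ltey.
have fin C : C `<=` A `|` B -> hausdorff1 C \is a fin_num.
  move=> CAB; rewrite ge0_fin_numE ?hausdorff1_ge0//.
  by apply: le_lt_trans (hausdorff1S CAB) _; rewrite ltey.
have fA := fin A (@subsetUl _ _ _); have fB := fin B (@subsetUr _ _ _).
rewrite -leeBrDr//; apply: hausdorff1_le => d d0.
have fdA : hausdorff1_delta d A \is a fin_num.
  rewrite ge0_fin_numE ?hausdorff1_delta_ge0//.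
  by apply: le_lt_trans (hausdorff1_delta_le _ d0) _; rewrite -ge0_fin_numE ?hausdorff1_ge0.
rewrite leeBrDr// addeC -leeBrDr//; apply: hausdorff1_le => e e0.
by rewrite leeBrDr// addeC; exact: key2.
Qed.

End Hausdorff.

Section HausdorffMeasure.
Variable R : realType.
Implicit Types (x y : plane R) (A B X : set (plane R)).
Local Open Scope ereal_scope.
Local Notation H := (@hausdorff1 R).

(** The part of [X] at height between [r + 1/(k+2)] and [r + 1/(k+1)] is at positive
    distance from the part above [r + 1/k], so that the measures of these slabs sum
    up to at most [2 H X]; hence [X] above [r] is exhausted by its parts at
    positive distance from the level [r]. *)
Lemma caratheodory_halfplane (f : plane R -> R) (r : R) :
  (forall x y, (`|f x - f y| <= enorm (x - y))%R) ->
  (@hausdorff1 R).-caratheodory [set x | (f x <= r)%R].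
Proof.
move=> flip; apply: le_caratheodory_measurable => X.
set C := [set x | _].
suff : H (X `&` C) + H (X `&` ~` C) <= H X by [].
have [->|Xoo] := eqVneq (H X) +oo; first by rewrite leey.
have sub Y : Y `<=` X -> H Y < +oo.
  by move=> YX; apply: le_lt_trans (hausdorff1S YX) _; rewrite ltey.
pose lev (k : nat) : R := (r + k.+1%:R^-1)%R.
have lev_dec k : (lev k.+1 < lev k)%R.
  by rewrite ltrD2l ltf_pV2 ?posrE ?ltr0n// ltr_nat.
pose Y k := X `&` [set x | (lev k <= f x)%R].
pose D k := X `&` [set x | (lev k.+1 <= f x < lev k)%R].
have YS k : Y k.+1 = Y k `|` D k.
  apply/seteqP; split => x.
    move=> [Xx /= lx]; case: (leP (lev k) (f x)) => h; first by left.
    by right; split => //=; rewrite lx h.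
  by move=> [[Xx /= lx]|[Xx /= /andP[lx _]]]; split => //=; apply: le_trans lx; exact: ltW.
have sep A B (s t : R) : (s < t)%R -> A `<=` [set x | (f x <= s)%R] ->
    B `<=` [set x | (t <= f x)%R] -> H A + H B <= H (A `|` B).
  move=> st As Bt; apply: (@hausdorff1_metric _ _ _ (t - s)%R).
    by rewrite subr_gt0.
  move=> x y /As /= fx /Bt /= fy; apply: le_trans (flip x y).
  by rewrite distrC ger0_norm; lra.
have step k : H (Y k) + H (D k.+1) <= H (Y k.+2).
  rewrite addeC; apply: le_trans (sep _ _ (lev k.+1) (lev k) _ _ _) _ => //.
  - by move=> x [_ /= /andP[_ /ltW]].
  - by move=> x [].
  - by apply: hausdorff1S; rewrite 2!YS => x [Dx|Yx]; [right|left; left].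
have bnd n : \sum_(0 <= k < n) H (D k.+1) <= H (Y n.+1) + H (Y n).
  elim: n => [|n IH]; first by rewrite big_geq// adde_ge0// hausdorff1_ge0.
  rewrite big_nat_recr//=; apply: le_trans (leeD2r _ IH) _.
  by rewrite -addeA addeC; apply: leeD2r; exact: step.
have sumoo : \sum_(0 <= k <oo) H (D k.+1) < +oo.
  apply: (@le_lt_trans _ _ (H X + H X)); last by rewrite lte_add_pinfty// ltey.
  apply: lime_le; first by apply: is_cvg_nneseries => *; exact: hausdorff1_ge0.
  apply: nearW => n; apply: le_trans (bnd n) _.
  by apply: leeD; apply: hausdorff1S; exact: subIsetl.
have upY m j : Y m `<=` Y (j + m)%N.
  by elim: j => // j IH x /IH; rewrite addSn YS; left.
have downY n j : Y (j + n.+1)%N `<=` Y n.+1 `|` \bigcup_(k in ~` `I_n) D k.+1.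
  elim: j => [|j IH] x; first by left.
  rewrite addSn YS => -[/IH//|Dx]; right; exists (j + n)%N; last by rewrite -addnS.
  by apply/negP; rewrite -leqNgt leq_addl.
have cover n : X `&` ~` C `<=` Y n.+1 `|` \bigcup_(k in ~` `I_n) D k.+1.
  move=> x [Xx /= /negP]; rewrite -ltNge => /ltr_add_invr[m mx].
  apply: (downY n m); rewrite addnC; apply: upY; split => //=; exact: ltW.
have tail n : H (X `&` C) + H (X `&` ~` C) <=
    H X + \sum_(n <= k <oo) H (D k.+1).
  apply: (@le_trans _ _ (H (X `&` C) + (H (Y n.+1) + \sum_(n <= k <oo) H (D k.+1)))).
    apply: leeD2l; apply: le_trans (hausdorff1S (cover n)) _.
    apply: le_trans (outer_measureU2 (@hausdorff1 R) _ _) _.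
    by apply: leeD2l; exact: outer_measure_sigma_subadditive_tail.
  rewrite addeA; apply: leeD2r.
  apply: le_trans (sep _ _ r (lev n.+1) _ _ _) _.
  - by rewrite ltrDl invr_gt0.
  - by move=> x [].
  - by move=> x [].
  - by apply: hausdorff1S => x [[]|[]].
have cvg0 : (fun n => H X + \sum_(n <= k <oo) H (D k.+1)) @ \oo --> H X + 0.
  apply: cvgeD; first by rewrite fin_num_adde_defl.
    exact: cvg_cst.
  by apply: nneseries_tail_cvg => // k _; exact: hausdorff1_ge0.
rewrite -[leRHS]adde0 -(cvg_lim _ cvg0)//.
apply: lime_ge; first by apply/cvg_ex; eexists; exact: cvg0.
exact: nearW.
Qed.

(** Half-planes bounded by a vertical or a horizontal line generate the Borel sets,
    and the coordinates are 1-Lipschitz. *)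
Lemma hausdorff1_caratheodory (A : set (mplane R)) :
  measurable A -> (@hausdorff1 R).-caratheodory (A : set (plane R)).
Proof.
have scara : sigma_algebra setT (@hausdorff1 R).-caratheodory.
  split; first exact: caratheodory_measurable_set0.
    by move=> B; rewrite setTD; exact: caratheodory_measurable_setC.
  exact: caratheodory_measurable_bigcup.
have pre (f : plane R -> R) : (forall x y, (`|f x - f y| <= enorm (x - y))%R) ->
    forall B : set (measurableTypeR R), measurable B ->
    (@hausdorff1 R).-caratheodory (f @^-1` B).
  move=> flip B; rewrite -[measurable]/((@ocitv R).-sigma.-measurable).
  rewrite RGenOInfty.measurableE => mB.
  suff : (@RGenOInfty.G R).-sigma.-measurable `<=`
      [set B | (@hausdorff1 R).-caratheodory (f @^-1` B)] by exact.
  apply: smallest_sub.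
    split => /=; first by rewrite preimage_set0; exact: caratheodory_measurable_set0.
      by move=> C; rewrite setTD preimage_setC; exact: caratheodory_measurable_setC.
    by move=> F mF; rewrite preimage_bigcup; exact: caratheodory_measurable_bigcup.
  move=> _ [x ->] /=.
  have -> : f @^-1` `]x, +oo[ = ~` [set y | (f y <= x)%R].
    by apply/seteqP; split => y /=; rewrite in_itv/= andbT ltNge => /negP.
  by apply: caratheodory_measurable_setC; exact: caratheodory_halfplane.
move=> mA; suff : @measurable _ (mplane R) `<=` (@hausdorff1 R).-caratheodory by exact.
apply: smallest_sub => //.
move=> _ [|] [B mB <-]; rewrite setTI; apply: pre => //.
  by move=> x y; exact: (ler_fst_enorm (x - y)%R).
by move=> x y; exact: (ler_snd_enorm (x - y)%R).
Qed.

Lemma hausdorff1_semi_sigma_additive :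
  semi_sigma_additive (@hausdorff1 R : set (mplane R) -> \bar R).
Proof.
move=> F mF tF mUF.
apply: (caratheodory_measure_sigma_additive (mu := @hausdorff1 R)) => //.
  by move=> i; exact: hausdorff1_caratheodory.
exact: hausdorff1_caratheodory.
Qed.

End HausdorffMeasure.

(** The Hausdorff measure on Borel sets, on which it is additive. *)
Definition borel_hausdorff1 (R : realType) : set (mplane R) -> \bar R :=
  @hausdorff1 R.

Section BorelHausdorff.
Variable R : realType.
HB.instance Definition _ := isMeasure.Build _ (mplane R) R (@borel_hausdorff1 R)
  (@hausdorff1_set0 R) (@hausdorff1_ge0 R) (@hausdorff1_semi_sigma_additive R).
End BorelHausdorff.


(** * Bounds for the Hausdorff measure *)

Section HausdorffBounds.
Variable R : realType.
Implicit Types (S A B : set (plane R)).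
Local Open Scope ereal_scope.

Lemma hausdorff1_lipschitz (T : plane R -> plane R) A :
  (forall x y, (enorm (T x - T y) <= enorm (x - y))%R) ->
  hausdorff1 (T @` A) <= hausdorff1 A.
Proof.
move=> lipT; apply: hausdorff1_le => d d0.
apply: le_trans (hausdorff1_delta_le A d0).
have diamT V : ediameter (T @` V) <= ediameter V.
  apply: ediameter_le; first exact: ediameter_ge0.
  move=> _ _ [x Vx <-] [y Vy <-]; apply: le_trans (enorm_le_ediameter Vx Vy).
  by rewrite lee_fin.
apply: le_ereal_inf_tmp => _ [U [cU dU] <-].
apply: (@le_trans _ _ (\sum_(i <oo) ediameter (T @` U i))).
  apply: ereal_inf_lbound; exists (fun i => T @` U i) => //; split.
    by move=> _ [x /cU[i _ Ux] <-]; exists i => //; exists x.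
  by move=> i; exact: le_trans (diamT _) (dU i).
by apply: lee_nneseries => [i _ _|i _] //; exact: ediameter_ge0.
Qed.

(** Cutting the range of [T] into short intervals cuts [S] into pieces whose
    diameters add up to at most the length of the range. *)
Lemma hausdorff1_expanding S (T : plane R -> R) (c d : R) :
  (forall v, S v -> (c <= T v <= d)%R) -> (c <= d)%R ->
  (forall v w, S v -> S w -> (enorm (v - w) <= `|T v - T w|)%R) ->
  hausdorff1 S <= (d - c)%:E.
Proof.
move=> Scd cd ST; apply: hausdorff1_le => e e0.
have [n ne] : exists n : nat, ((d - c) / n.+1%:R <= e)%R.
  have : (0 <= (d - c) / e)%R by rewrite divr_ge0 ?subr_ge0// ltW.
  move=> /archi_boundP; set n := Num.bound _ => hn; exists n.
  rewrite ler_pdivrMr ?ltr0n// mulrC -ler_pdivrMr//.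
  by apply: le_trans (ltW hn) _; rewrite ler_nat.
pose h := ((d - c) / n.+1%:R)%R.
have h0 : (0 <= h)%R by rewrite divr_ge0 ?subr_ge0.
have hn : (n.+1%:R * h = d - c)%R by rewrite mulrC divfK.
pose U i := [set v | S v /\ (i < n.+1)%N /\ (c + i%:R * h <= T v <= c + i.+1%:R * h)%R].
have dU i : ediameter (U i) <= h%:E.
  apply: ediameter_le; first by rewrite lee_fin.
  move=> x y [Sx [_ /andP[x1 x2]]] [Sy [_ /andP[y1 y2]]]; rewrite lee_fin.
  apply: le_trans (ST _ _ Sx Sy) _; rewrite ler_norml.
  by move: x1 x2 y1 y2; rewrite -natr1 mulrDl mul1r; lra.
apply: (@le_trans _ _ (\sum_(i <oo) ediameter (U i))).
  apply: ereal_inf_lbound; exists U => //; split => [v Sv|i]; last first.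
    by apply: le_trans (dU i) _; rewrite lee_fin.
  have /andP[cv vd] := Scd _ Sv.
  have ex : exists i, (T v <= c + i.+1%:R * h)%R.
    by exists n; rewrite hn; lra.
  case: (ex_minnP ex) => i iv imin; exists i => //; split => //; split.
    by rewrite ltnS; apply: imin; rewrite hn; lra.
  rewrite iv andbT; case: i imin {iv} => [|i] imin; first by rewrite mul0r addr0.
  by rewrite leNgt; apply/negP => /ltW/imin; rewrite ltnn.
rewrite (nneseries_split _ n.+1); last by move=> *; exact: ediameter_ge0.
rewrite eseries0 ?adde0; last first.
  move=> i; rewrite add0n => ni _; rewrite (_ : U i = set0) ?ediameter0//.
  by apply/seteqP; split => // v [_ [+ _]]; rewrite ltnNge ni.
rewrite add0n big_mkord; apply: (@le_trans _ _ (\sum_(i < n.+1) h%:E)).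
  by apply: lee_sum => i _; exact: dU.
by rewrite sumEFin lee_fin sumr_const card_ord -[(h *+ _)%R]mulr_natl hn.
Qed.

(** A 1-Lipschitz image of a cover of [S] covers the interval, in pieces that are
    contained in intervals not longer than the diameters of the covering sets. *)
Lemma hausdorff1_ge_image S (f : plane R -> R) (c d : R) :
  (forall v w, (`|f v - f w| <= enorm (v - w))%R) ->
  `]c, d[ `<=` f @` S -> (d - c)%:E <= hausdorff1 S.
Proof.
move=> flip cdS.
apply: le_trans (hausdorff1_delta_le S (@ltr01 R)).
apply: le_ereal_inf_tmp => _ [U [cU dU] <-].
pose I i : set (measurableTypeR R) :=
  if `[< U i !=set0 >] then `[inf (f @` U i), sup (f @` U i)]%classic else set0.
have fin i : ediameter (U i) \is a fin_num.
  rewrite ge0_fin_numE ?ediameter_ge0//; apply: le_lt_trans (dU i) _.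
  by rewrite ltry.
have fU i x y : U i x -> U i y -> (f x - f y <= fine (ediameter (U i)))%R.
  move=> Ux Uy; rewrite -lee_fin fineK//.
  apply: le_trans (enorm_le_ediameter Ux Uy); rewrite lee_fin.
  exact: le_trans (ler_norm _) (flip _ _).
have supI i x : U i x -> has_sup (f @` U i).
  move=> Ux; split; first by exists (f x); exists x.
  exists (f x + fine (ediameter (U i)))%R => _ [y Uy <-].
  by rewrite -lerBlDl; exact: fU.
have infI i x : U i x -> has_inf (f @` U i).
  move=> Ux; split; first by exists (f x); exists x.
  exists (f x - fine (ediameter (U i)))%R => _ [y Uy <-].
  by rewrite lerBlDr -lerBlDl; exact: fU.
have mI i : measurable (I i) by rewrite /I; case: asboolP.
have lI i : lebesgue_measure (I i) <= ediameter (U i).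
  rewrite /I; case: asboolP => [[x Ux]|_]; last by rewrite measure0 ediameter_ge0.
  rewrite lebesgue_measure_itv/=; case: ifP => _; last exact: ediameter_ge0.
  rewrite -EFinD -(fineK (fin i)) lee_fin lerBlDr.
  apply: ge_sup; first by exists (f x); exists x.
  move=> _ [y Uy <-]; rewrite -lerBlDl; apply: lb_le_inf.
    by exists (f x); exists x.
  by move=> _ [z Uz <-]; rewrite lerBlDl -lerBlDr; exact: fU.
case: (ltP c d) => cd; last first.
  apply: (@le_trans _ _ 0); first by rewrite lee_fin subr_le0.
  by apply: nneseries_ge0 => *; exact: ediameter_ge0.
have <- : lebesgue_measure (`]c, d[%classic : set (measurableTypeR R)) = (d - c)%:E.
  by rewrite lebesgue_measure_itv/= lte_fin cd EFinB.
apply: (@le_trans _ _ (\sum_(i <oo) lebesgue_measure (I i))); last first.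
  by apply: lee_nneseries => [i _ _|i _].
apply: measure_sigma_subadditive => //.
move=> _ /cdS[v Sv <-]; have [i _ Uv] := cU _ Sv; exists i => //.
rewrite /I; case: asboolP => [_|[]]; last by exists v.
rewrite /= in_itv/=; apply/andP; split.
  by apply: ge_inf; [exact: (infI _ _ Uv).2|exists v].
by apply: ub_le_sup; [exact: (supI _ _ Uv).2|exists v].
Qed.

End HausdorffBounds.

(** * The Euclidean norm as a sum of seminorms of rank one *)

Section Zonogon.
Variable R : realType.
Implicit Types (x y : R) (v : plane R).

Lemma cos_lipschitz x y : `|cos x - cos y| <= `|x - y|.
Proof.
wlog xy : x y / y <= x.
  by move=> h; case: (leP y x) => [/h//|/ltW/h]; rewrite distrC [leRHS]distrC.
have [|c _ ->] := @MVT_segment R cos (fun t => - sin t) y x xy.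
  by apply: continuous_subspaceT => z; exact: continuous_cos.
by rewrite normrM normrN ler_piMl// sin_max.
Qed.

(** The odd multiples of [pi / 2n] in [0, pi]; no direction is horizontal. *)
Let theta n (k : nat) : R := (k.*2.+1)%:R * (pi / n.*2%:R).

Let spread n x : R := \sum_(k < n) `|cos (x - theta n k)|.

Let theta_in n k : (k < n)%N -> 0 < theta n k < pi.
Proof.
move=> kn; have n0 : (0 < n)%N by case: n kn.
have n2 : (0 : R) < n.*2%:R by rewrite ltr0n double_gt0.
rewrite /theta; apply/andP; split.
  by rewrite mulr_gt0 ?ltr0n// divr_gt0// pi_gt0.
rewrite mulrA ltr_pdivrMr// mulrC ltr_pM2l ?pi_gt0// ltr_nat.
by rewrite -doubleS leq_double.
Qed.

Let spread_periodic n x : spread n (x + pi / n%:R) = spread n x.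
Proof.
case: n => [|n]; first by rewrite /spread !big_ord0.
have n0 : n.+1%:R != 0 :> R by rewrite pnatr_eq0.
have n20 : n.+1.*2%:R != 0 :> R by rewrite pnatr_eq0.
have d2 : n.+1.*2%:R = 2 * n.+1%:R :> R by rewrite -muln2 natrM mulrC.
rewrite /spread big_ord_recl [RHS]big_ord_recr/= [RHS]addrC; congr (_ + _); last first.
  apply: eq_bigr => i _; congr (`|cos _|).
  rewrite /theta d2 /= /bump leq0n add1n (doubleS i) -(natr1 i.*2.+2) -(natr1 i.*2.+1).
  by field; rewrite addrC natr1.
have -> : x + pi / n.+1%:R - theta n.+1 0 = (x - theta n.+1 n) + pi.
  rewrite /theta d2 double0 -(natr1 n.*2) -muln2 natrM -(natr1 n).
  by field; rewrite natr1.
by rewrite cosDpi normrN.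
Qed.

Let spread_lipschitz n x y : `|spread n x - spread n y| <= n%:R * `|x - y|.
Proof.
rewrite /spread -sumrB; apply: le_trans (ler_norm_sum _ _ _) _.
apply: (@le_trans _ _ (\sum_(k < n) `|x - y|)); last first.
  by rewrite sumr_const card_ord mulr_natl.
apply: ler_sum => k _; apply: le_trans (ler_dist_dist _ _) _.
apply: le_trans (cos_lipschitz _ _) _.
by have -> : x - theta n k - (y - theta n k) = x - y by ring.
Qed.

(** The period of the spread is [pi / n] and its Lipschitz constant is [n], so
    that it oscillates by at most [pi] around values of order [n]. *)
Let spread_osc n x : (0 < n)%N -> 0 <= x -> `|spread n x - spread n 0| <= pi.
Proof.
move=> n0 x0; have nr : (0 : R) < n%:R by rewrite ltr0n.
have p0 : (0 : R) < pi / n%:R by rewrite divr_gt0 ?pi_gt0.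
pose j := Num.truncn (x / (pi / n%:R)); pose y := x - j%:R * (pi / n%:R).
have /andP[jx xj] : j%:R <= x / (pi / n%:R) < j.+1%:R.
  by rewrite truncn_itv// divr_ge0// ltW.
have -> : spread n x = spread n y.
  rewrite -[in LHS](subrK (j%:R * (pi / n%:R)) x) -/y; elim: (j) => [|i IH].
    by rewrite mul0r addr0.
  by rewrite -natr1 mulrDl mul1r addrA spread_periodic IH.
apply: le_trans (spread_lipschitz n y 0) _; rewrite subr0.
have y0 : 0 <= y by rewrite subr_ge0 -ler_pdivlMr.
rewrite ger0_norm// mulrC -ler_pdivlMr// /y lerBlDr.
move: xj; rewrite ltr_pdivrMr// -natr1 mulrDl mul1r => /ltW.
by rewrite addrC.
Qed.

Let spread_ge n : (0 < n)%N -> (n%:R - pi) / 2 <= spread n 0.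
Proof.
move=> n0; have : n%:R <= spread n 0 + spread n (pi / 2).
  rewrite /spread -big_split/=; apply: (@le_trans _ _ (\sum_(k < n) 1)).
    by rewrite sumr_const card_ord.
  apply: ler_sum => k _; rewrite sub0r cosN -[pi / 2 - _]opprB cosN cosBpihalf.
  rewrite -(cos2Dsin2 (theta n k)) -(real_normK (num_real (cos _))).
  rewrite -(real_normK (num_real (sin _))).
  have := cos_max (theta n k); have := sin_max (theta n k).
  have := normr_ge0 (cos (theta n k)); have := normr_ge0 (sin (theta n k)).
  by rewrite !expr2; nra.
have := @spread_osc n (pi / 2) n0 (divr_ge0 (pi_ge0 R) (ler0n _ _)).
rewrite ler_norml => /andP[_]; lra.
Qed.

Let polar v : exists s psi : R, [/\ 0 <= psi, `|s| = enorm v,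
  v.1 = s * cos psi & v.2 = s * sin psi].
Proof.
have [r0|rn0] := eqVneq (enorm v) 0.
  exists 0, 0; rewrite r0 normr0 !mul0r; split => //; apply/eqP;
    rewrite -normr_le0 -r0; [exact: ler_fst_enorm|exact: ler_snd_enorm].
have r0 : 0 < enorm v by rewrite lt_neqAle eq_sym rn0 enorm_ge0.
pose sg : R := if 0 <= v.2 then 1 else -1.
have sg2 : sg * sg = 1 by rewrite /sg; case: ifP; rewrite ?mulN1r ?opprK ?mul1r.
have nsg : `|sg| = 1 by rewrite /sg; case: ifP; rewrite ?normrN normr1.
have sgv2 : sg * v.2 = `|v.2|.
  rewrite /sg; case: (leP 0 v.2) => h; first by rewrite mul1r ger0_norm.
  by rewrite mulN1r ltr0_norm.
pose c := sg * v.1 / enorm v.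
have c1 : -1 <= c <= 1.
  rewrite -ler_norml /c !normrM nsg mul1r normfV (gtr0_norm r0).
  by rewrite ler_pdivrMr// mul1r ler_fst_enorm.
exists (sg * enorm v), (acos c); split.
- exact: acos_ge0.
- by rewrite normrM nsg mul1r gtr0_norm.
- rewrite acosK// /c; transitivity (sg * sg * v.1 * (enorm v / enorm v)); last by ring.
  by rewrite sg2 divff// mul1r mulr1.
- rewrite sin_acos//.
  have -> : 1 - c ^+ 2 = (`|v.2| / enorm v) ^+ 2.
    rewrite /c !exprMn exprVn sqr_enorm (expr2 sg) sg2 mul1r real_normK ?num_real//.
    have : v.1 ^+ 2 + v.2 ^+ 2 != 0 by rewrite -sqr_enorm expf_neq0.
    by move=> h; field.
  rewrite sqrtr_sqr ger0_norm; last by rewrite divr_ge0// ltW.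
  by rewrite -sgv2; transitivity (sg * sg * v.2 * (enorm v / enorm v)); [rewrite sg2 divff// mul1r mulr1|ring].
Qed.

(** The plane is isometric to a subspace of L1, up to any relative error and with
    finitely many coordinates: the unit ball is approximated by the polar of a
    zonogon with many equal sides. The condition [0 < q i] makes each functional
    convex on convex graphs. *)
Lemma zonogon_norm (e : R) : 0 < e ->
  exists n, exists p q : nat -> R, (forall i, (i < n)%N -> 0 < q i) /\
  forall v : plane R,
    enorm v <= \sum_(i < n) `|p i * v.1 + q i * v.2| <= (1 + e) * enorm v.
Proof.
move=> e0; pose B : R := 2 * ((2 + e) * pi / e) + pi.
have pi0 := pi_gt0 R.
have b0 : 0 < (2 + e) * pi / e by rewrite divr_gt0// mulr_gt0// addr_gt0.
have B0 : 0 <= B by rewrite /B; lra.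
have nB := archi_boundP B0; set n := Num.bound B in nB.
have n0 : (0 < n)%N by rewrite -(ltr0n R); exact: le_lt_trans nB.
have Sn := spread_ge n0.
have Sb : (2 + e) * pi / e < spread n 0.
  by apply: lt_le_trans Sn; rewrite ltr_pdivlMr//; move: nB; rewrite /B; lra.
have Se : (2 + e) * pi < e * spread n 0 by rewrite [ltRHS]mulrC -ltr_pdivrMr.
pose D := spread n 0 - pi.
have D0 : 0 < D.
  rewrite subr_gt0 -(ltr_pM2l e0); apply: le_lt_trans Se.
  by rewrite ler_pM2r//; lra.
exists n, (fun k => cos (theta n k) / D), (fun k => sin (theta n k) / D).
split=> [i i_n|v]; first by rewrite divr_gt0// sin_gt0_pi// theta_in.
have [s [psi [psi0 <- v1 v2]]] := polar v.
have -> : \sum_(i < n) `|cos (theta n i) / D * v.1 + sin (theta n i) / D * v.2|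
    = `|s| * (spread n psi / D).
  rewrite /spread mulrA mulr_sumr mulr_suml; apply: eq_bigr => i _.
  rewrite v1 v2 (_ : _ + _ = s * cos (psi - theta n i) / D).
    by rewrite !normrM normfV (gtr0_norm D0).
  by rewrite cosB; ring.
have := spread_osc n0 psi0; rewrite ler_norml => /andP[l u].
apply/andP; split.
  by rewrite -[leLHS]mulr1 ler_wpM2l// ler_pdivlMr// mul1r /D; lra.
rewrite [leRHS]mulrC ler_wpM2l// ler_pdivrMr// /D; move: l u Se.
set S0 := spread n 0; set S1 := spread n psi => l u.
by rewrite !mulrDl mulrBr mul1r; lra.
Qed.

End Zonogon.

(** * Moments of convex functions on an interval *)

Section BoundedMeasurable.
Variables (R : realType) (a b : R).
Implicit Types (f g : R -> R).

(** A class of integrable functions that is closed under products. *)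
Definition bounded_measurable f :=
  measurable_fun `[a, b]%classic f /\
  exists M, forall x, a <= x <= b -> `|f x| <= M.

Definition itv_integral f : R := \int[@lebesgue_measure R]_(x in `[a, b]) f x.

Lemma bounded_measurable_integrable f :
  bounded_measurable f -> (@lebesgue_measure R).-integrable `[a, b] (EFin \o f).
Proof.
move=> [mf [M fM]]; apply: measurable_bounded_integrable => //.
  by rewrite /= lebesgue_measure_itv/=; case: ifP => // _; rewrite -EFinB ltry.
exists M; split; first exact: num_real.
by move=> N MN x /= /[!in_itv]/= /fM h; exact: le_trans h (ltW MN).
Qed.

Lemma bounded_measurableD f g : bounded_measurable f -> bounded_measurable g ->
  bounded_measurable (fun x => f x + g x).
Proof.
move=> [mf [M fM]] [mg [N gN]]; split; first exact: measurable_funD.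
by exists (M + N) => x ab; apply: le_trans (ler_normD _ _) (lerD (fM x ab) (gN x ab)).
Qed.

Lemma bounded_measurableM f g : bounded_measurable f -> bounded_measurable g ->
  bounded_measurable (fun x => f x * g x).
Proof.
move=> [mf [M fM]] [mg [N gN]]; split; first exact: measurable_funM.
by exists (M * N) => x ab; rewrite normrM ler_pM ?fM ?gN.
Qed.

Lemma bounded_measurable_cst (k : R) : bounded_measurable (fun=> k).
Proof. by split => //; exists `|k|. Qed.

Lemma bounded_measurable_id : bounded_measurable id.
Proof.
split; first exact: measurable_id.
exists (`|a| + `|b|) => x /andP[ax xb]; rewrite ler_norml.
have := ler_norm a; have := ler_norm (- a); rewrite normrN.
have := ler_norm b; have := ler_norm (- b); rewrite normrN.
by have := normr_ge0 a; have := normr_ge0 b; lra.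
Qed.

Lemma bounded_measurableZ (k : R) f : bounded_measurable f ->
  bounded_measurable (fun x => k * f x).
Proof. exact: bounded_measurableM (bounded_measurable_cst k). Qed.

Lemma bounded_measurableN f : bounded_measurable f ->
  bounded_measurable (fun x => - f x).
Proof.
move=> bf; rewrite (_ : (fun x => - f x) = (fun x => -1 * f x)).
  exact: bounded_measurableZ.
by apply/funext => x; rewrite mulN1r.
Qed.

Lemma bounded_measurableB f g : bounded_measurable f -> bounded_measurable g ->
  bounded_measurable (fun x => f x - g x).
Proof. by move=> bf bg; apply: bounded_measurableD => //; exact: bounded_measurableN. Qed.

Lemma itv_integralD f g : bounded_measurable f -> bounded_measurable g ->
  itv_integral (fun x => f x + g x) = itv_integral f + itv_integral g.
Proof. by move=> bf bg; apply: RintegralD => //; exact: bounded_measurable_integrable. Qed.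

Lemma itv_integralB f g : bounded_measurable f -> bounded_measurable g ->
  itv_integral (fun x => f x - g x) = itv_integral f - itv_integral g.
Proof. by move=> bf bg; apply: RintegralB => //; exact: bounded_measurable_integrable. Qed.

Lemma itv_integralZ k f : bounded_measurable f ->
  itv_integral (fun x => k * f x) = k * itv_integral f.
Proof. by move=> bf; apply: RintegralZl => //; exact: bounded_measurable_integrable. Qed.

Lemma le_itv_integral f g : bounded_measurable f -> bounded_measurable g ->
  (forall x, a <= x <= b -> f x <= g x) -> itv_integral f <= itv_integral g.
Proof.
by move=> bf bg fg; apply: le_Rintegral => //; exact: bounded_measurable_integrable.
Qed.

Lemma eq_itv_integral f g : (forall x, a <= x <= b -> f x = g x) ->
  itv_integral f = itv_integral g.
Proof.
by move=> fg; apply: eq_Rintegral => x /[!inE]/= /[!in_itv]/= /fg.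
Qed.

Lemma itv_integral_ge0 f : (forall x, a <= x <= b -> 0 <= f x) ->
  0 <= itv_integral f.
Proof. by move=> f0; apply: Rintegral_ge0 => x /= /[!in_itv]/= /f0. Qed.

Lemma itv_integral_quadratic (p q r : R) : a < b ->
  itv_integral (fun x => p + q * x + r * x ^+ 2) =
  (p * b + q * (b ^+ 2 / 2) + r * (b ^+ 3 / 3))
  - (p * a + q * (a ^+ 2 / 2) + r * (a ^+ 3 / 3)).
Proof.
move=> ab; pose F (x : R) := p * x + q / 2 * x ^+ 2 + r / 3 * x ^+ 3.
have dF (x : R) : is_derive x 1 F (p + q * x + r * x ^+ 2).
  apply: is_derive_eq; rewrite /GRing.scale/=.
  by field.
have cF : continuous F.
  by move=> x; apply: differentiable_continuous; apply/derivable1_diffP; case: (dF x).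
rewrite /itv_integral /Rintegral (@continuous_FTC2 _ _ F)//.
- by rewrite /F /=; field.
- apply: continuous_subspaceT => x.
  apply: cvgD; last by apply: cvgM; [exact: cvg_cst|exact: exprn_continuous].
  by apply: cvgD; [exact: cvg_cst|apply: cvgM; [exact: cvg_cst|exact: cvg_id]].
- split; first by move=> x _; case: (dF x).
    exact/cvg_at_right_filter/cF.
  exact/cvg_at_left_filter/cF.
- by move=> x _; rewrite derive1E; exact: derive_val.
Qed.

End BoundedMeasurable.

Section ConvexMoments.
Variable R : realType.
Implicit Types (a b c : R) (f : R -> R).

(** Convexity with the denominators cleared, so that degenerate triples need no
    separate treatment. *)
Definition convex_on a b f := forall x y z, a <= x -> x <= y -> y <= z -> z <= b ->
  (z - x) * f y <= (z - y) * f x + (y - x) * f z.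

Lemma bounded_measurableS a b c f : a <= c -> bounded_measurable a b f ->
  bounded_measurable c b f.
Proof.
move=> ac [mf [M fM]]; split.
  apply: measurable_funS mf => // x /=; rewrite !in_itv/= => /andP[cx ->].
  by rewrite (le_trans ac cx).
by exists M => x /andP[cx xb]; apply: fM; rewrite (le_trans ac cx).
Qed.

Lemma le_itv_integral_right a b c f : a <= c -> c <= b ->
  bounded_measurable a b f -> (forall x, a <= x <= c -> 0 <= f x) ->
  itv_integral c b f <= itv_integral a b f.
Proof.
move=> ac cb bf f0.
have fi := bounded_measurable_integrable bf.
have := @Rintegral_itvB R f (BLeft a) (BRight b) c fi.
rewrite !bnd_simp => /(_ ac cb) E.
rewrite /itv_integral -[leRHS](subrK (\int[lebesgue_measure]_(t in `[a, c]) f t)%R).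
rewrite E Rintegral_itv_obnd_cbnd; last first.
  apply: integrableS fi => // x /=; rewrite !in_itv/= => /andP[/ltW cx ->].
  by rewrite (le_trans ac cx).
by rewrite lerDl; exact: itv_integral_ge0.
Qed.

(** The line through [(b, W)] and the graph of [f] at [x0] lies below [f] on [[c, x0]]
    and above it on [[x0, b]], so that it may replace [f] against the weight
    [x0 - x]; the point [x0] is placed so that the slope of the line does not
    contribute. *)
Lemma convex_moment_ge a b c W f : a <= c -> c < b -> bounded_measurable a b f ->
  convex_on a b f -> (forall x, a <= x <= b -> 0 <= f x) -> f b <= W ->
  - (W * (b - c) ^+ 2 / 6) <=
  itv_integral a b (fun x => (b - 2 * (b - c) / 3 - x) * f x).
Proof.
move=> ac cb bf cf f0 fbW; set x0 := b - 2 * (b - c) / 3.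
have cx0 : c < x0 by rewrite /x0; lra.
have x0b : x0 < b by rewrite /x0; lra.
pose k := (W - f x0) / (b - x0).
have bx0 : b - x0 != 0 by rewrite subr_eq0 gt_eqF.
have kE : f x0 = W - k * (b - x0) by rewrite /k divfK//; ring.
have bw g : bounded_measurable a b g -> bounded_measurable a b (fun x => (x0 - x) * g x).
  move=> bg; apply: bounded_measurableM => //; apply: bounded_measurableB.
    exact: bounded_measurable_cst.
  exact: bounded_measurable_id.
apply: le_trans (@le_itv_integral_right a b c _ ac (ltW cb) (bw _ bf) _); last first.
  by move=> x /andP[ax xc]; rewrite mulr_ge0 ?f0 ?ax/=; lra.
apply: (@le_trans _ _ (itv_integral c b (fun x => (x0 - x) * (W - k * (b - x))))).
  rewrite (@eq_itv_integral _ _ _ _ (fun x => x0 * (W - k * b) +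
    (x0 * k - (W - k * b)) * x + - k * x ^+ 2)); last by move=> x _; ring.
  rewrite itv_integral_quadratic// le_eqVlt; apply/orP; left; apply/eqP.
  by rewrite /x0; field.
have bl : bounded_measurable a b (fun x => W - k * (b - x)).
  apply: bounded_measurableB; first exact: bounded_measurable_cst.
  apply: bounded_measurableZ; apply: bounded_measurableB.
    exact: bounded_measurable_cst.
  exact: bounded_measurable_id.
apply: le_itv_integral; [exact: bounded_measurableS (bw _ bl)|
  exact: bounded_measurableS (bw _ bf)|].
move=> x /andP[cx xb].
have [xx0|x0x] := leP x x0.
  rewrite ler_wpM2l ?subr_ge0//.
  have := cf x x0 b (le_trans ac cx) xx0 (ltW x0b) (lexx _).
  rewrite kE => h.
  rewrite -subr_ge0 -(@pmulr_rge0 _ (b - x0)) ?subr_gt0//.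
  have : 0 <= (x0 - x) * (W - f b) by rewrite mulr_ge0// subr_ge0.
  by move: h; lra.
rewrite ler_wnM2l; [by []|by rewrite subr_le0 ltW|].
have := cf x0 x b (le_trans ac (ltW cx0)) (ltW x0x) xb (lexx _).
rewrite kE => h.
rewrite -subr_ge0 -(@pmulr_rge0 _ (b - x0)) ?subr_gt0//.
have : 0 <= (x - x0) * (W - f b) by rewrite mulr_ge0 ?subr_ge0// ltW.
by move: h; lra.
Qed.

(** For a body whose boundary has variation [W - eta x + gam x] on the left of [x] and
    whose section at [x] is [W - eta x - gam x], this says that the two centers are
    at distance at most [(b - a) / 6]. With [V = W (b - a)], and [E] and [D] the
    integrals of [eta] and [gam], the moment bounds, taken with [c = a] for [eta] and
    with [b - c = D / W + (b - a) / 2] for [gam], leave the slack [(E - V / 2)^2]. *)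
Lemma convex_pair_moment_le a b W (eta gam : R -> R) : a < b -> 0 < W ->
  bounded_measurable a b eta -> bounded_measurable a b gam ->
  convex_on a b eta -> convex_on a b gam ->
  (forall x, a <= x <= b -> 0 <= eta x) -> (forall x, a <= x <= b -> 0 <= gam x) ->
  eta b <= 0 -> gam a <= 0 -> gam b <= W ->
  2 * W * itv_integral a b (fun x => (b - x) * (W - eta x - gam x)) <=
  (itv_integral a b (fun x => W - eta x + gam x) + W * (b - a) / 3)
    * itv_integral a b (fun x => W - eta x - gam x).
Proof.
move=> ab W0 beta bgam ceta cgam eta0 gam0 etab gama gamb.
set I := itv_integral a b.
have ID f g : bounded_measurable a b f -> bounded_measurable a b g ->
  I (fun x => f x + g x) = I f + I g by exact: itv_integralD.
have IB f g : bounded_measurable a b f -> bounded_measurable a b g ->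
  I (fun x => f x - g x) = I f - I g by exact: itv_integralB.
have IZ k f : bounded_measurable a b f -> I (fun x => k * f x) = k * I f.
  exact: itv_integralZ.
have bc k : bounded_measurable a b (fun=> k) by exact: bounded_measurable_cst.
have bid : bounded_measurable a b (fun x : R => x) := bounded_measurable_id _ _.
have bu : bounded_measurable a b (fun x => b - x) by exact: bounded_measurableB.
pose E := I eta; pose D := I gam.
pose Eu := I (fun x => (b - x) * eta x); pose Du := I (fun x => (b - x) * gam x).
have IW : I (fun=> W) = W * (b - a).
  rewrite /I (@eq_itv_integral _ _ _ _ (fun x => W + 0 * x + 0 * x ^+ 2)).
    by rewrite itv_integral_quadratic//; ring.
  by move=> x _; ring.
have IuW : I (fun x => (b - x) * W) = W * (b - a) ^+ 2 / 2.
  rewrite /I (@eq_itv_integral _ _ _ _ (fun x => b * W + (- W) * x + 0 * x ^+ 2)).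
    by rewrite itv_integral_quadratic//; field.
  by move=> x _; ring.
have Ih : I (fun x => W - eta x - gam x) = W * (b - a) - E - D.
  by rewrite !IB ?IW//; exact: bounded_measurableB.
have IP : I (fun x => W - eta x + gam x) = W * (b - a) - E + D.
  by rewrite ID ?IB ?IW//; exact: bounded_measurableB.
have bM f : bounded_measurable a b f -> bounded_measurable a b (fun x => (b - x) * f x).
  exact: bounded_measurableM.
have Iuh : I (fun x => (b - x) * (W - eta x - gam x)) = W * (b - a) ^+ 2 / 2 - Eu - Du.
  rewrite /I (@eq_itv_integral _ _ _ _ (fun x => (b - x) * W - (b - x) * eta x
     - (b - x) * gam x)); last by move=> x _; ring.
  rewrite -/I !IB ?IuW//; do ?exact: bM.
  by apply: bounded_measurableB; exact: bM.
have moment f r : bounded_measurable a b f ->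
    I (fun x => (b - r - x) * f x) = I (fun x => (b - x) * f x) - r * I f.
  move=> bf; rewrite -IZ// -IB.
  - by apply: eq_itv_integral => x _; ring.
  - exact: bM.
  - exact: bounded_measurableZ.
have D0 : 0 <= D by exact: itv_integral_ge0.
have DV : D <= W * (b - a) / 2.
  have -> : W * (b - a) / 2 = I (fun x => W / (b - a) * (x - a)).
    rewrite /I (@eq_itv_integral _ _ _ _ (fun x => - (W / (b - a) * a)
      + (W / (b - a)) * x + 0 * x ^+ 2)); last by move=> x _; ring.
    by rewrite itv_integral_quadratic//; field; lra.
  apply: le_itv_integral => //.
    by apply: bounded_measurableZ; exact: bounded_measurableB.
  move=> x /andP[ax xb].
  have := cgam a x b (lexx _) ax xb (lexx _) => h.
  rewrite mulrAC ler_pdivlMr ?subr_gt0// mulrC.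
  have : (b - x) * gam a <= 0 by rewrite mulr_ge0_le0 ?subr_ge0.
  have : (x - a) * gam b <= (x - a) * W by rewrite ler_wpM2l ?subr_ge0.
  by move: h; lra.
have F1 : 2 * (b - a) / 3 * E <= Eu.
  have := @convex_moment_ge a b a 0 eta (lexx _) ab beta ceta eta0 etab.
  by rewrite -/I moment// -/E -/Eu; lra.
(* The value [2 D / W] of [b - c] would give the best bound for [gam]; the one below
   loses a square but satisfies [c < b] even if [D = 0]. *)
pose c := b - (D / W + (b - a) / 2).
have DW : D / W <= (b - a) / 2 by rewrite ler_pdivrMr//; lra.
have DW0 : 0 <= D / W by rewrite divr_ge0// ltW.
have ac : a <= c by rewrite /c; lra.
have cb : c < b by rewrite /c; lra.
have := @convex_moment_ge a b c W gam ac cb bgam cgam gam0 gamb.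
rewrite -/I moment// -/D -/Du (_ : b - c = D / W + (b - a) / 2); last by rewrite /c; ring.
have -> : W * (D / W + (b - a) / 2) ^+ 2 / 6 = (D + W * (b - a) / 2) ^+ 2 / 6 / W.
  by field; lra.
have -> : 2 * (D / W + (b - a) / 2) / 3 * D = 2 * (D + W * (b - a) / 2) / 3 * D / W.
  by field; lra.
rewrite lerBrDr => F2.
have {}F2 : - ((D + W * (b - a) / 2) ^+ 2 / 6) + 2 * (D + W * (b - a) / 2) / 3 * D <= Du * W.
  by rewrite -ler_pdivrMr// mulrDl mulNr.
rewrite Iuh IP Ih -subr_ge0.
have : 0 <= (E - W * (b - a) / 2) ^+ 2 by exact: sqr_ge0.
have : 2 * (b - a) / 3 * E * W <= Eu * W by rewrite ler_pM2r.
move: F2; set w := b - a; rewrite !expr2 => F2 F3 F4; lra.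
Qed.

End ConvexMoments.

(** * The length of a convex graph *)

Section Variation.
Variable R : realType.
Implicit Types (f g : R -> R) (a b m x y : R).

(** For a convex [f] with minimum at [m], the total variation of [f] up to [x],
    normalized to vanish at [m]. *)
Definition signed_variation f m x := f (Num.max x m) - f (Num.min x m).

Lemma signed_variation_left f m x : x <= m -> signed_variation f m x = f m - f x.
Proof. by move=> xm; rewrite /signed_variation (max_idPr xm) (min_idPl xm). Qed.

Lemma signed_variation_right f m x : m <= x -> signed_variation f m x = f x - f m.
Proof. by move=> mx; rewrite /signed_variation (max_idPl mx) (min_idPr mx). Qed.

Section Convex.
Variables (f : R -> R) (a b m : R).
Hypotheses (cf : convex_on a b f) (am : a <= m) (mb : m <= b).
Hypothesis fm : forall x, a <= x <= b -> f m <= f x.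

Lemma convex_decreasing x y : a <= x -> x <= y -> y <= m -> f y <= f x.
Proof.
move=> ax xy ym; have [xm|xm] := eqVneq x m.
  by have -> : y = x by apply/eqP; rewrite eq_le xy xm ym.
have {}xm : x < m by rewrite lt_neqAle xm (le_trans xy ym).
have h := cf ax xy ym mb; have h2 := fm (_ : a <= x <= b).
rewrite -(@ler_pM2l _ (m - x)) ?subr_gt0//.
have : 0 <= (y - x) * (f x - f m).
  by rewrite mulr_ge0 ?subr_ge0// h2// ax (le_trans (ltW xm)).
by move: h; lra.
Qed.

Lemma convex_increasing x y : m <= x -> x <= y -> y <= b -> f x <= f y.
Proof.
move=> mx xy yb; have [my|my] := eqVneq m y.
  by have -> : y = x by apply/eqP; rewrite eq_le xy -my mx.
have {}my : m < y by rewrite lt_neqAle my (le_trans mx xy).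
have h := cf am mx xy yb; have h2 := fm (_ : a <= y <= b).
rewrite -(@ler_pM2l _ (y - m)) ?subr_gt0//.
have : 0 <= (y - x) * (f y - f m).
  by rewrite mulr_ge0 ?subr_ge0// h2// yb (le_trans (le_trans am mx)).
by move: h; lra.
Qed.

Lemma le_signed_variation x y : a <= x -> x <= y -> y <= b ->
  `|f y - f x| <= signed_variation f m y - signed_variation f m x.
Proof.
move=> ax xy yb; rewrite ler_norml.
have [ym|my] := leP y m.
  rewrite !signed_variation_left// ?(le_trans xy)//.
  by have := convex_decreasing ax xy ym; lra.
have [xm|mx] := leP x m.
  rewrite (signed_variation_right _ (ltW my)) signed_variation_left//.
  have := fm (_ : a <= x <= b); rewrite ax (le_trans xm)// => /(_ isT).
  have := fm (_ : a <= y <= b); rewrite yb (le_trans ax)// => /(_ isT).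
  by lra.
rewrite (signed_variation_right _ (ltW my)) (signed_variation_right _ (ltW mx)).
by have := convex_increasing (ltW mx) xy yb; lra.
Qed.

Lemma signed_variation_eq x y : a <= x -> x <= y -> y <= b -> y <= m \/ m <= x ->
  signed_variation f m y - signed_variation f m x = `|f y - f x|.
Proof.
move=> ax xy yb [ym|mx].
  have xm := le_trans xy ym.
  rewrite !signed_variation_left// distrC ger0_norm; first by ring.
  by rewrite subr_ge0 convex_decreasing.
have my := le_trans mx xy.
rewrite !signed_variation_right// ger0_norm; first by ring.
by rewrite subr_ge0 convex_increasing.
Qed.

Lemma convex_on_left_part : convex_on a b (fun x => f (Num.min x m) - f m).
Proof.
move=> x y z ax xy yz zb.
have [my|ym] := leP m y.
  rewrite (min_idPr (le_trans my yz)) subrr !mulr0 addr0.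
  rewrite mulr_ge0 ?subr_ge0// fm// le_min ax am ge_min; apply/orP; right; exact: mb.
rewrite (min_idPl (le_trans xy (ltW ym))).
have [mz|zm] := leP m z.
  rewrite subrr mulr0 addr0.
  have h := cf ax xy (ltW ym) mb.
  have : (z - m) * f y <= (z - m) * f x.
    by rewrite ler_wpM2l ?subr_ge0// convex_decreasing// ltW.
  by move: h; lra.
by have := cf ax xy yz zb; lra.
Qed.

Lemma convex_on_right_part : convex_on a b (fun x => f (Num.max x m) - f m).
Proof.
move=> x y z ax xy yz zb.
have [ym|my] := leP y m.
  rewrite (max_idPr (le_trans xy ym)) subrr !mulr0 add0r.
  rewrite mulr_ge0 ?subr_ge0// fm// le_max am orbT ge_max mb zb//.
rewrite (max_idPl (le_trans (ltW my) yz)).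
have [xm|mx] := leP x m.
  rewrite subrr mulr0 add0r.
  have h := cf am (ltW my) yz zb.
  have : (m - x) * f y <= (m - x) * f z.
    by rewrite ler_wpM2l ?subr_ge0// convex_increasing// ltW.
  by move: h; lra.
by have := cf ax xy yz zb; lra.
Qed.

End Convex.
End Variation.

Section Graph.
Variable R : realType.
Variables (g : R -> R) (a b e : R) (n : nat) (p q m : nat -> R).
Hypothesis cg : continuous g.
Let f k x := p k * x + q k * g x.
Hypothesis zono : forall v : plane R,
  enorm v <= \sum_(i < n) `|p i * v.1 + q i * v.2| <= (1 + e) * enorm v.
Hypothesis cf : forall k, (k < n)%N -> convex_on a b (f k).
Hypothesis mk : forall k, (k < n)%N -> a <= m k <= b.
Hypothesis mf : forall k x, (k < n)%N -> a <= x <= b -> f k (m k) <= f k x.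

Definition graph_over (D : set R) : set (plane R) := [set v | D v.1 /\ v.2 = g v.1].

Let variation x := \sum_(k < n) signed_variation (f k) (m k) x.

Let pairing k (x y : R) :
  p k * (y - x) + q k * (g y - g x) = f k y - f k x.
Proof. by rewrite /f; ring. Qed.

(** Along the graph the sum of the variations grows at least as fast as the
    distance. *)
Lemma hausdorff1_graph_le x y : a <= x -> x <= y -> y <= b ->
  (hausdorff1 (graph_over `[x, y]) <= (variation y - variation x)%:E)%E.
Proof.
move=> ax xy yb.
have mono s t : x <= s -> s <= t -> t <= y ->
    \sum_(k < n) `|f k t - f k s| <= variation t - variation s.
  move=> xs st ty; rewrite /variation -sumrB; apply: ler_sum => k _.
  have /andP[am mb] := mk (ltn_ord k).
  apply: (le_signed_variation (cf (ltn_ord k)) am mb) => //.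
  - by move=> z; exact: mf.
  - exact: le_trans xs.
  - exact: le_trans yb.
have dist s t : x <= s -> s <= t -> t <= y ->
    enorm ((t - s, g t - g s) : plane R) <= variation t - variation s.
  move=> xs st ty; have /andP[h _] := zono (t - s, g t - g s).
  apply: le_trans h _; apply: le_trans (mono _ _ xs st ty).
  by apply: ler_sum => k _ /=; rewrite pairing.
have vmono s t : x <= s -> s <= t -> t <= y -> variation s <= variation t.
  by move=> xs st ty; rewrite -subr_ge0; apply: le_trans (dist _ _ xs st ty); exact: enorm_ge0.
apply: (@hausdorff1_expanding _ _ (fun v : plane R => variation v.1)).
- move=> v [] /=; rewrite in_itv/= => /andP[xv vy] _.
  by rewrite !vmono.
- exact: vmono.
- move=> [v1 v2] [w1 w2] [] /=; rewrite in_itv/= => /andP[xv vy] -> [] /=.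
  rewrite in_itv/= => /andP[xw wy] ->.
  have [vw|wv] := leP w1 v1.
    by apply: le_trans (dist _ _ xw vw vy) _; rewrite ler_norm.
  rewrite distrC; apply: le_trans (ler_norm _); apply: le_trans (dist _ _ xv (ltW wv) wy).
  rewrite /enorm/= -[v1 - w1]opprB -[g v1 - g w1]opprB.
  by rewrite !sqrrN.
Qed.

(** Where every [f k] is monotone the variation is that of the chord, and an arc is
    not shorter than its chord; the minima [m k] cut the graph into such arcs. *)
Lemma hausdorff1_graph_ge x y : 0 < e -> a <= x -> x <= y -> y <= b ->
  ((variation y - variation x)%:E <= (1 + e)%:E * hausdorff1 (graph_over `]x, y]))%E.
Proof.
move: x y => x0 y0 e0.
pose Q x y : Prop :=
  ((variation y - variation x)%:E <= (1 + e)%:E * hausdorff1 (graph_over `]x, y]))%E.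
have mgr c d : @measurable _ (mplane R) (graph_over `]c, d]).
  have -> : graph_over `]c, d] = (fst @^-1` `]c, d]) `&`
      ((fun v : mplane R => (v.2 : R) - g v.1) @^-1` [set 0]).
    apply/seteqP; split => v [] /= h1 h2; split => //=.
      by rewrite h2 subrr.
    by apply/eqP; rewrite -subr_eq0 h2.
  apply: measurableI.
    by rewrite -[X in measurable X]setTI; exact: measurable_fst.
  rewrite -[X in measurable X]setTI.
  apply: (measurable_funB measurable_snd) => //.
  apply: measurableT_comp; last exact: measurable_fst.
  exact: continuous_measurable_fun.
have Qadd x z y : a <= x -> x <= z -> z <= y -> y <= b -> Q x z -> Q z y -> Q x y.
  move=> ax xz zy yb Qxz Qzy; rewrite /Q.
  have -> : graph_over `]x, y] = graph_over `]x, z] `|` graph_over `]z, y].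
    apply/seteqP; split => v.
      rewrite /graph_over /= !in_itv/= => -[/andP[xv vy] ->].
      by case: (leP v.1 z) => h; [left|right]; split => //; rewrite ?xv ?h ?vy.
    rewrite /graph_over /= !in_itv/=.
    move=> [[/andP[xv vz] ->]|[/andP[zv vy] ->]]; split => //.
      by rewrite xv (le_trans vz).
    by rewrite vy (le_lt_trans xz).
  rewrite -[hausdorff1 _]/(borel_hausdorff1 _) measureU//; last first.
    apply/seteqP; split => // v; rewrite /graph_over /= !in_itv/=.
    by move=> [[/andP[_ vz] _] [/andP[zv _] _]]; move: vz; rewrite leNgt zv.
  rewrite ge0_muleDr ?measure_ge0//.
  have -> : variation y - variation x =
    (variation z - variation x) + (variation y - variation z) by ring.
  by rewrite EFinD; apply: leeD.
have Qbase x y : a <= x -> x <= y -> y <= b ->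
    (forall k, (k < n)%N -> y <= m k \/ m k <= x) -> Q x y.
  move=> ax xy yb sep; rewrite /Q.
  have -> : variation y - variation x = \sum_(k < n) `|f k y - f k x|.
    rewrite /variation -sumrB; apply: eq_bigr => k _.
    have /andP[am mb] := mk (ltn_ord k).
    apply: (signed_variation_eq (cf (ltn_ord k)) am mb) => //; last exact: sep.
    by move=> z; exact: mf.
  pose d : plane R := (y - x, g y - g x).
  have -> : \sum_(k < n) `|f k y - f k x| = \sum_(k < n) `|p k * d.1 + q k * d.2|.
    by apply: eq_bigr => k _; rewrite pairing.
  have /andP[_ h] := zono d.
  apply: (@le_trans _ _ ((1 + e) * enorm d)%:E); first by rewrite lee_fin.
  rewrite EFinM; apply: lee_wpmul2l; first by rewrite lee_fin; lra.
  have [d0|dn0] := eqVneq (enorm d) 0; first by rewrite d0 hausdorff1_ge0.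
  have d0 : 0 < enorm d by rewrite lt_neqAle eq_sym dn0 enorm_ge0.
  pose u : plane R := (d.1 / enorm d, d.2 / enorm d).
  have u1 : u.1 ^+ 2 + u.2 ^+ 2 = 1.
    rewrite !exprMn -mulrDl -sqr_enorm -exprMn divff//; exact: expr1n.
  pose l (v : plane R) := u.1 * v.1 + u.2 * v.2.
  have <- : l (y, g y) - l (x, g x) = enorm d.
    rewrite -[RHS](mulfK dn0) -expr2 sqr_enorm /l /u /d/=.
    by field.
  apply: (@hausdorff1_ge_image _ _ l).
    move=> v w; rewrite (_ : l v - l w = u.1 * (v - w).1 + u.2 * (v - w).2).
      exact: ler_enorm_dot.
    by rewrite /l/=; ring.
  move=> t /=; rewrite in_itv/= => /andP[lt tl].
  have cl : {within `[x, y], continuous (fun s => l (s, g s))}.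
    apply: continuous_subspaceT => s; rewrite /l/=.
    by apply: cvgD; apply: cvgM; [exact: cvg_cst|exact: cvg_id|exact: cvg_cst|exact: cg].
  have [|s] := @IVT R (fun s => l (s, g s)) x y t xy cl.
    by rewrite ge_min le_max (ltW lt) (ltW tl) orbT.
  rewrite in_itv/= => /andP[xs sy] st; exists (s, g s) => //; split => //=.
  rewrite in_itv/= sy andbT lt_neqAle xs andbT; apply/eqP => E.
  by move: lt; rewrite -st -E ltxx.
suff H j : (j <= n)%N -> forall x y, a <= x -> x <= y -> y <= b ->
    (forall k, (j <= k < n)%N -> y <= m k \/ m k <= x) -> Q x y.
  by move=> ax xy yb; apply: (H n) => // k /andP[/leq_ltn_trans/[apply]]; rewrite ltnn.
elim: j => [|j IH] jn s t ax xy yb sep.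
  by apply: Qbase => // k kn; apply: sep.
have [ym|my] := leP t (m j).
  apply: IH => //; first exact: ltnW.
  move=> k /andP[]; rewrite leq_eqVlt => /predU1P[<- _|jk kn]; first by left.
  by apply: sep; rewrite jk.
have [mx|xm] := leP (m j) s.
  apply: IH => //; first exact: ltnW.
  move=> k /andP[]; rewrite leq_eqVlt => /predU1P[<- _|jk kn]; first by right.
  by apply: sep; rewrite jk.
apply: (Qadd _ (m j)) => //; try exact: ltW.
  apply: IH => //; [exact: ltnW|exact: ltW|exact: le_trans (ltW my) yb|].
  move=> k /andP[]; rewrite leq_eqVlt => /predU1P[<- _|jk kn]; first by left.
  by case: (sep k) => [|h|h]; [rewrite jk|left; apply: le_trans h; exact: ltW|right].
apply: IH => //; [exact: ltnW|exact: le_trans ax (ltW xm)|exact: ltW|].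
move=> k /andP[]; rewrite leq_eqVlt => /predU1P[<- _|jk kn]; first by right.
by case: (sep k) => [|h|h]; [rewrite jk|left|right; apply: le_trans h _; exact: ltW].
Qed.

End Graph.

(** * The layer-cake formula *)

Section LayerCake.
Context d (T : measurableType d) (R : realType).
Variables (mu : {measure set T -> \bar R}) (D : set T) (f : T -> R) (a b : R).
Hypotheses (mD : measurable D) (muD : (mu D < +oo)%E).
Hypotheses (mf : measurable_fun setT f) (fab : forall x, D x -> a <= f x <= b).

(** Fubini on the set of pairs [(x, t)] with [f x <= t <= b]. *)
Lemma layer_cake : (\int[mu]_(x in D) (b - f x)%:E =
  \int[lebesgue_measure]_(t in `[a, b]) mu (D `&` [set x | (f x <= t)%R]))%E.
Proof.
pose m : {finite_measure set T -> \bar R} := mfrestr mD muD.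
pose S := [set z : T * measurableTypeR R | D z.1 /\ (f z.1 <= z.2 <= b)%R].
have mS : measurable S.
  have -> : S = (D `*` `]-oo, b]) `&`
      ((fun z : T * measurableTypeR R => (f z.1 <= (z.2 : R))%R) @^-1` [set true]).
    apply/seteqP; split => z /=; rewrite /S/= in_itv/=.
      by move=> [Dz /andP[fz zb]].
    by move=> [[Dz zb] fz]; split => //; rewrite fz.
  apply: measurableI; first exact: measurableX.
  rewrite -[X in measurable X]setTI.
  apply: (measurable_fun_ler (f := fun z : T * measurableTypeR R => f z.1)) => //.
  exact: measurableT_comp.
have : (m \x lebesgue_measure)%E S = (m \x^ lebesgue_measure)%E S.
  apply: product_measure_unique => //= A B mA mB.
  exact: product_measure2E.
rewrite /product_measure1 /product_measure2 => E.
transitivity (\int[m]_x (lebesgue_measure \o xsection S) x)%E.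
  rewrite (@eq_measure_integral _ _ _ D m); last first.
    by move=> A mA AD; rewrite /m /= /mfrestr /mrestr setIidl.
  rewrite integral_mkcond; apply: eq_integral => x _ /=.
  rewrite /patch; case: ifPn => [/set_mem Dx|/negP Dx].
    have -> : xsection S x = `[f x, b]%classic.
      by apply/seteqP; split => t; rewrite xsectionP /S/= in_itv/= => // -[].
    have /andP[_ fb] := fab Dx.
    rewrite lebesgue_measure_itv/= lte_fin; by case: ltgtP fb => // -> _; rewrite subrr.
  rewrite (_ : xsection S x = set0) ?measure0//.
  apply/seteqP; split => // t; rewrite xsectionP /S/= => -[Dx' _].
  by apply: Dx; rewrite inE.
rewrite {}E [RHS]integral_mkcond; apply: eq_integral => t _ /=.
have -> : ysection S t = D `&` [set x | (f x <= t <= b)%R].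
  by apply/seteqP; split => x; rewrite ysectionP.
rewrite /m /= /mfrestr /mrestr /patch /=; case: ifPn => [|/negP tab].
  rewrite inE/= in_itv/= => /andP[at_ tb]; congr (mu _).
  apply/seteqP; split => x /=; first by move=> [[Dx /andP[-> _]] _].
  by move=> [Dx ->]; rewrite tb.
rewrite (_ : _ `&` D = set0) ?measure0//.
apply/seteqP; split => // x /= [[Dx /andP[ft tb]] _]; apply: tab.
have /andP[af _] := fab Dx.
by rewrite inE/= in_itv/= tb andbT (le_trans af).
Qed.

End LayerCake.

(** * The region between a convex and a concave graph *)

Section Continuous.
Variables (R : realType) (a b : R).
Implicit Types f g : R -> R.

Lemma continuous_bounded_measurable f : continuous f -> bounded_measurable a b f.
Proof.
move=> cf; split.
  by apply: measurable_funTS; exact: continuous_measurable_fun.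
have [ab|ba] := leP a b; last first.
  by exists 0 => x /andP[ax xb]; move: ba; rewrite ltNge (le_trans ax xb).
have [|c _ fc] := @EVT_max R (fun x => `|f x|) a b ab.
  by apply: continuous_subspaceT => x; apply: cvg_norm; exact: cf.
by exists `|f c| => x xab; apply: fc; rewrite in_itv.
Qed.

Lemma continuous_comp_min f m : continuous f -> continuous (fun x => f (Num.min x m)).
Proof.
move=> cf x; apply: (@continuous_comp _ _ _ (fun x => Num.min x m) f); last exact: cf.
by apply: continuous_min; [exact: cvg_id|exact: cvg_cst].
Qed.

Lemma continuous_comp_max f m : continuous f -> continuous (fun x => f (Num.max x m)).
Proof.
move=> cf x; apply: (@continuous_comp _ _ _ (fun x => Num.max x m) f); last exact: cf.
by apply: continuous_max; [exact: cvg_id|exact: cvg_cst].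
Qed.

Lemma continuous_signed_variation f m :
  continuous f -> continuous (signed_variation f m).
Proof.
move=> cf x; apply: cvgB; [exact: continuous_comp_max|exact: continuous_comp_min].
Qed.

Lemma convex_onD f g : convex_on a b f -> convex_on a b g ->
  convex_on a b (fun x => f x + g x).
Proof.
move=> cf cg x y z ax xy yz zb.
by have := cf x y z ax xy yz zb; have := cg x y z ax xy yz zb; lra.
Qed.

Lemma bounded_measurable_sum (h : nat -> R -> R) k :
  (forall i, bounded_measurable a b (h i)) ->
  bounded_measurable a b (fun x => \sum_(i < k) h i x).
Proof.
move=> bh; elim: k => [|k IH].
  by under eq_fun do rewrite big_ord0; exact: bounded_measurable_cst.
by under eq_fun do rewrite big_ord_recr/=; exact: bounded_measurableD.
Qed.

Lemma itv_integral_sum (h : nat -> R -> R) k :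
  (forall i, bounded_measurable a b (h i)) ->
  itv_integral a b (fun x => \sum_(i < k) h i x) =
  \sum_(i < k) itv_integral a b (h i).
Proof.
move=> bh; elim: k => [|k IH].
  under eq_itv_integral do rewrite big_ord0.
  by rewrite big_ord0 /itv_integral Rintegral_cst//= mul0r.
rewrite big_ord_recr/= -IH -itv_integralD//; last exact: bounded_measurable_sum.
by apply: eq_itv_integral => x _; rewrite big_ord_recr.
Qed.

(** The right end point is negligible. *)
Lemma le_itv_integral_co f g : bounded_measurable a b f -> bounded_measurable a b g ->
  (forall x, a <= x -> x < b -> f x <= g x) -> itv_integral a b f <= itv_integral a b g.
Proof.
move=> bf bg fg; have bi h : bounded_measurable a b h ->
    (@lebesgue_measure R).-integrable `[a, b[ (EFin \o h).
  move=> bh; apply: integrableS (bounded_measurable_integrable bh) => // x /=.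
  by rewrite !in_itv/= => /andP[-> /ltW].
rewrite /itv_integral -!Rintegral_itv_bndo_bndc; [|exact: bi..].
apply: le_Rintegral => //; [exact: bi..|].
by move=> x /=; rewrite in_itv/= => /andP[ax xb]; exact: fg.
Qed.

End Continuous.

Section Body.
Variable R : realType.
Variables (a b : R) (al be : R -> R).
Hypothesis ab : a < b.
Hypotheses (cal : continuous al) (cbe : continuous be).
Hypotheses (xal : convex_on a b al) (xbe : convex_on a b (fun x => - be x)).
Hypothesis al_le_be : forall x, a <= x <= b -> al x <= be x.
Hypothesis al_lt_be : forall x, a < x < b -> al x < be x.

Definition region : set (mplane R) :=
  [set v | a <= v.1 <= b /\ al v.1 <= v.2 <= be v.1].

Definition frame : set (mplane R) := [set v | region v /\
  (v.1 = a \/ v.1 = b \/ v.2 = al v.1 \/ v.2 = be v.1)].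

Let side x0 : set (mplane R) := [set v | v.1 = x0 /\ al x0 <= v.2 <= be x0].

Let measurable_left (g : R -> R) : continuous g ->
  measurable_fun setT (fun v : mplane R => g v.1).
Proof.
move=> cg; apply: measurableT_comp; last exact: measurable_fst.
exact: continuous_measurable_fun.
Qed.

Let measurable_le (f g : mplane R -> R) : measurable_fun setT f ->
  measurable_fun setT g -> measurable [set v | f v <= g v].
Proof.
move=> mf mg; rewrite (_ : [set v | _] = (fun v => f v <= g v) @^-1` [set true])//.
by rewrite -[X in measurable X]setTI; exact: measurable_fun_ler.
Qed.

Let measurable_eq (f g : mplane R -> R) : measurable_fun setT f ->
  measurable_fun setT g -> measurable [set v | f v = g v].
Proof.
move=> mf mg; rewrite (_ : [set v | _] = [set v | f v <= g v] `&` [set v | g v <= f v]).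
  by apply: measurableI; exact: measurable_le.
apply/seteqP; split => v /=; first by move=> ->.
by move=> [h1 h2]; apply/eqP; rewrite eq_le h1.
Qed.

Let mfst : measurable_fun setT (fun v : mplane R => v.1 : R) := @measurable_fst _ _ _ _.
Let msnd : measurable_fun setT (fun v : mplane R => v.2 : R) := @measurable_snd _ _ _ _.

Lemma measurable_region : measurable region.
Proof.
rewrite (_ : region = ([set v | a <= v.1] `&` [set v | v.1 <= b]) `&`
    ([set v | al v.1 <= v.2] `&` [set v | v.2 <= be v.1])); last first.
  by apply/seteqP; split => v /=; [move=> [/andP[? ?] /andP[? ?]]|
    move=> [[h1 h2] [h3 h4]]; split; apply/andP].
by apply: measurableI; apply: measurableI; apply: measurable_le => //;
  exact: measurable_left.
Qed.

Lemma measurable_frame : measurable frame.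
Proof.
rewrite (_ : frame = region `&` ([set v | v.1 = a] `|` ([set v | v.1 = b] `|`
   ([set v | v.2 = al v.1] `|` [set v | v.2 = be v.1]))))//.
apply: measurableI; first exact: measurable_region.
by do 3 (apply: measurableU; first by apply: measurable_eq => //; exact: measurable_left);
  apply: measurable_eq => //; exact: measurable_left.
Qed.

Let measurable_graph (g : R -> R) x y : continuous g ->
  @measurable _ (mplane R) (graph_over g `]x, y]).
Proof.
move=> cg; rewrite (_ : graph_over g `]x, y] = (`]x, y] `*` setT) `&`
    [set v | v.2 = g v.1]).
  apply: measurableI; first exact: measurableX.
  by apply: measurable_eq => //; exact: measurable_left.
by apply/seteqP; split => v /=; [move=> []|move=> [[]]].
Qed.

Let measurable_side x0 : measurable (side x0).
Proof.
rewrite (_ : side x0 = [set v | v.1 = x0] `&` ([set v | al x0 <= v.2] `&`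
    [set v | v.2 <= be x0])).
  apply: measurableI; first exact: measurable_eq.
  by apply: measurableI; exact: measurable_le.
by apply/seteqP; split => v /=; [move=> [? /andP[]]|move=> [? [? ?]]; split => //; apply/andP].
Qed.

Let hausdorff1_side x0 : al x0 <= be x0 ->
  hausdorff1 (side x0) = (be x0 - al x0)%:E.
Proof.
move=> le0; apply/eqP; rewrite eq_le; apply/andP; split.
  apply: (@hausdorff1_expanding _ _ (fun v : plane R => v.2)) => //.
    by move=> v [].
  move=> v w [v1 _] [w1 _]; rewrite enorm_le// /= v1 w1 subrr expr0n add0r.
  by rewrite real_normK// num_real.
apply: (@hausdorff1_ge_image _ _ (fun v : plane R => v.2)).
  by move=> v w; exact: (ler_snd_enorm (v - w)).
move=> t /=; rewrite in_itv/= => /andP[/ltW h1 /ltW h2].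
by exists (x0, t) => //; split => //=; rewrite h1.
Qed.

Definition left_length t : \bar R := hausdorff1 (frame `&` [set v | v.1 <= t]).

Section Directions.
Variables (e : R) (n : nat) (p q m m' : nat -> R).
Hypothesis e0 : 0 < e.
Hypothesis q0 : forall i, (i < n)%N -> 0 < q i.
Hypothesis zono : forall v : plane R,
  enorm v <= \sum_(i < n) `|p i * v.1 + q i * v.2| <= (1 + e) * enorm v.
Let f k (x : R) : R := p k * x + q k * al x.
Let f' k (x : R) : R := - p k * x + - q k * be x.
Hypothesis mk : forall k, (k < n)%N -> a <= m k <= b.
Hypothesis mf : forall k x, (k < n)%N -> a <= x <= b -> f k (m k) <= f k x.
Hypothesis mk' : forall k, (k < n)%N -> a <= m' k <= b.
Hypothesis mf' : forall k x, (k < n)%N -> a <= x <= b -> f' k (m' k) <= f' k x.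

Let cf k : (k < n)%N -> convex_on a b (f k).
Proof.
move=> kn x y z ax xy yz zb; have := xal ax xy yz zb.
rewrite -subr_ge0 => /(mulr_ge0 (ltW (q0 kn))) h; rewrite -subr_ge0; apply: le_trans h _.
by rewrite le_eqVlt /f; apply/orP; left; apply/eqP; ring.
Qed.

Let cf' k : (k < n)%N -> convex_on a b (f' k).
Proof.
move=> kn x y z ax xy yz zb; have := xbe ax xy yz zb.
rewrite -subr_ge0 => /(mulr_ge0 (ltW (q0 kn))) h; rewrite -subr_ge0; apply: le_trans h _.
by rewrite le_eqVlt /f'; apply/orP; left; apply/eqP; ring.
Qed.

Let zono' (v : plane R) :
  enorm v <= \sum_(i < n) `|- p i * v.1 + - q i * v.2| <= (1 + e) * enorm v.
Proof.
under eq_bigr do rewrite !mulNr -opprD normrN; exact: zono.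
Qed.

(** The maximum of [p k * v.1 + q k * v.2] over the region, attained on the upper graph,
    minus its minimum, attained on the lower one. *)
Let width k := - f k (m k) - f' k (m' k).

(** The total variation of the functional of index [k] along the part of the frame on
    the left of [x], which is the left side and an arc of each graph. *)
Let left_variation k x :=
  width k + signed_variation (f k) (m k) x + signed_variation (f' k) (m' k) x.

Let sum_q : 1 <= \sum_(i < n) q i <= 1 + e.
Proof.
have := zono (0, 1); rewrite /enorm/= expr0n expr1n add0r sqrtr1 mulr1.
by under eq_bigr => i _ do rewrite mulr0 add0r mulr1 (gtr0_norm (q0 (ltn_ord i))).
Qed.

Let left_variationE x : \sum_(k < n) left_variation k x =
  (\sum_(i < n) q i) * (be a - al a) +
  (\sum_(k < n) signed_variation (f k) (m k) x -
   \sum_(k < n) signed_variation (f k) (m k) a) +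
  (\sum_(k < n) signed_variation (f' k) (m' k) x -
   \sum_(k < n) signed_variation (f' k) (m' k) a).
Proof.
rewrite mulr_suml -!sumrB -!big_split/=; apply: eq_bigr => k _.
have /andP[am _] := mk (ltn_ord k); have /andP[am' _] := mk' (ltn_ord k).
rewrite /left_variation !(@signed_variation_left _ _ _ a)// /width /f /f'.
by ring.
Qed.

(** For [t < b] the left side and the two arcs, without their left end points, are
    disjoint, so that their lengths add up. *)
Lemma sum_left_variation_le t : a <= t -> t < b ->
  ((\sum_(k < n) left_variation k t)%:E <= (1 + e)%:E * left_length t)%E.
Proof.
move=> at_ tb; have tlb := ltW tb.
have side_a : (((\sum_(i < n) q i) * (be a - al a))%:E <=
    (1 + e)%:E * borel_hausdorff1 (side a))%E.
  have le_a : al a <= be a by rewrite al_le_be// lexx ltW.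
  rewrite [borel_hausdorff1 _]hausdorff1_side// -EFinM lee_fin.
  by rewrite ler_wpM2r ?subr_ge0//; case/andP: sum_q.
have ga := hausdorff1_graph_ge cal zono cf mk mf e0 (lexx a) at_ tlb.
have gb := hausdorff1_graph_ge cbe zono' cf' mk' mf' e0 (lexx a) at_ tlb.
rewrite left_variationE !EFinD.
apply: le_trans (leeD (leeD side_a ga) gb) _.
rewrite -[hausdorff1 (graph_over al _)]/(borel_hausdorff1 _).
rewrite -[hausdorff1 (graph_over be _)]/(borel_hausdorff1 _).
rewrite -!ge0_muleDr ?measure_ge0 ?adde_ge0//.
rewrite -measureU//; [|exact: measurable_graph|]; last first.
  apply/seteqP; split => // v [[v1 _] []] /=.
  by rewrite v1 in_itv/= ltxx.
rewrite -measureU//; [|by apply: measurableU => //; exact: measurable_graph|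
  exact: measurable_graph|]; last first.
  apply/seteqP; split => // v [[[v1 _]|[/= + v2]] [/= + v2']].
    by rewrite v1 in_itv/= ltxx.
  rewrite in_itv/= => /andP[av vt] _.
  have := al_lt_be (_ : a < v.1 < b); rewrite av (le_lt_trans vt tb) => /(_ isT).
  by rewrite -v2 -v2' ltxx.
apply: lee_wpmul2l; first by rewrite lee_fin addr_ge0// ltW.
apply: (@hausdorff1S R _ (frame `&` [set v | v.1 <= t])) => v [[[v1 v2]|[]]|[]] /=.
- by rewrite /frame /region /= v1 lexx (ltW ab); split => //; split => //; left.
- rewrite in_itv/= => /andP[av vt] v2; split => //.
  have vab : a <= v.1 <= b by rewrite (ltW av) (le_trans vt).
  by rewrite /frame /region /= vab v2 lexx al_le_be//=; split => //; right; right; left.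
- rewrite in_itv/= => /andP[av vt] v2; split => //.
  have vab : a <= v.1 <= b by rewrite (ltW av) (le_trans vt).
  by rewrite /frame /region /= vab v2 lexx al_le_be//=; split => //; right; right; right.
Qed.

(** A closed convex curve is swept twice by each functional. *)
Lemma hausdorff1_frame_le :
  (hausdorff1 frame <= (2 * \sum_(k < n) width k)%:E)%E.
Proof.
have h c : a <= c <= b ->
    (hausdorff1 (side c) <= ((\sum_(i < n) q i) * (be c - al c))%:E)%E.
  move=> cab; rewrite hausdorff1_side ?al_le_be// lee_fin ler_peMl ?subr_ge0 ?al_le_be//.
  by case/andP: sum_q.
have ha : a <= a <= b by rewrite lexx ltW.
have hb : a <= b <= b by rewrite lexx ltW.
move: ha hb => /h ha /h hb.
have ga := hausdorff1_graph_le zono cf mk mf (lexx a) (ltW ab) (lexx b).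
have gb := hausdorff1_graph_le zono' cf' mk' mf' (lexx a) (ltW ab) (lexx b).
have sub : frame `<=` side a `|` (side b `|` (graph_over al `[a, b] `|` graph_over be `[a, b])).
  move=> v [[vab vv] [v1|[v1|[v2|v2]]]].
  - by left; rewrite v1 in vv.
  - by right; left; rewrite v1 in vv.
  - by right; right; left; split => //=; rewrite in_itv.
  - by right; right; right; split => //=; rewrite in_itv.
apply: le_trans (hausdorff1S sub) _.
have U2 A B (r s : R) : (hausdorff1 A <= r%:E -> hausdorff1 B <= s%:E ->
    hausdorff1 (A `|` B) <= (r + s)%:E)%E.
  move=> Ar Bs; apply: le_trans (outer_measureU2 (@hausdorff1 R) A B) _.
  by rewrite EFinD leeD.
apply: le_trans (U2 _ _ _ _ ha (U2 _ _ _ _ hb (U2 _ _ _ _ ga gb))) _.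
rewrite lee_fin le_eqVlt; apply/orP; left; apply/eqP.
rewrite !mulr_suml -!sumrB -!big_split/= mulr_sumr; apply: eq_bigr => k _.
have /andP[am bm] := mk (ltn_ord k); have /andP[am' bm'] := mk' (ltn_ord k).
rewrite !(@signed_variation_left _ _ _ a)// !(@signed_variation_right _ _ _ b)//.
by rewrite /width /f /f'; ring.
Qed.


Let Ik := itv_integral a b (fun x => be x - al x).
Let Iuk := itv_integral a b (fun x => (b - x) * (be x - al x)).

Let cont_f k : continuous (f k).
Proof.
move=> x; apply: cvgD; apply: cvgM; [exact: cvg_cst|exact: cvg_id|exact: cvg_cst|exact: cal].
Qed.

Let cont_f' k : continuous (f' k).
Proof.
move=> x; apply: cvgD; apply: cvgM; [exact: cvg_cst|exact: cvg_id|exact: cvg_cst|exact: cbe].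
Qed.

Let bounded_measurable_left_variation k : bounded_measurable a b (left_variation k).
Proof.
apply: bounded_measurableD; first apply: bounded_measurableD.
- exact: bounded_measurable_cst.
- exact/continuous_bounded_measurable/continuous_signed_variation.
- exact/continuous_bounded_measurable/continuous_signed_variation.
Qed.

(** The decreasing and the increasing parts of the functional along both graphs form
    the pair of convex functions of the moment inequality. *)
Let left_variation_moment k : (k < n)%N ->
  2 * width k * Iuk <= (itv_integral a b (left_variation k) + width k * (b - a) / 3) * Ik.
Proof.
move=> kn; have /andP[am bm] := mk kn; have /andP[am' bm'] := mk' kn.
have fmin x : a <= x <= b -> f k (m k) <= f k x by exact: mf.
have fmin' x : a <= x <= b -> f' k (m' k) <= f' k x by exact: mf'.
pose L x := f k (Num.min x (m k)) - f k (m k).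
pose L' x := f' k (Num.min x (m' k)) - f' k (m' k).
pose G x := f k (Num.max x (m k)) - f k (m k).
pose G' x := f' k (Num.max x (m' k)) - f' k (m' k).
have hE x : width k - (L x + L' x) - (G x + G' x) = q k * (be x - al x).
  have E1 : f k (Num.min x (m k)) + f k (Num.max x (m k)) = f k x + f k (m k).
    by case: (leP x (m k)) => _; rewrite // addrC.
  have E2 : f' k (Num.min x (m' k)) + f' k (Num.max x (m' k)) = f' k x + f' k (m' k).
    by case: (leP x (m' k)) => _; rewrite // addrC.
  transitivity (- f k x - f' k x); last by rewrite /f /f'; ring.
  transitivity (f k (m k) + f' k (m' k)
    - (f k (Num.min x (m k)) + f k (Num.max x (m k)))
    - (f' k (Num.min x (m' k)) + f' k (Num.max x (m' k)))).
    by rewrite /width /L /L' /G /G'; ring.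
  by rewrite E1 E2; ring.
have PE x : width k - (L x + L' x) + (G x + G' x) = left_variation k x.
  by rewrite /left_variation /signed_variation /L /L' /G /G'; ring.
have fin_min x : a <= x <= b -> a <= Num.min x (m k) <= b.
  by move=> /andP[ax xb]; rewrite le_min ax am ge_min xb.
have fin_max x : a <= x <= b -> a <= Num.max x (m k) <= b.
  by move=> /andP[ax xb]; rewrite le_max ax ge_max xb bm.
have fin_min' x : a <= x <= b -> a <= Num.min x (m' k) <= b.
  by move=> /andP[ax xb]; rewrite le_min ax am' ge_min xb.
have fin_max' x : a <= x <= b -> a <= Num.max x (m' k) <= b.
  by move=> /andP[ax xb]; rewrite le_max ax ge_max xb bm'.
have eta0 x : a <= x <= b -> 0 <= L x + L' x.
  by move=> xab; rewrite addr_ge0 ?subr_ge0 ?fmin ?fmin'// ?fin_min// fin_min'.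
have gam0 x : a <= x <= b -> 0 <= G x + G' x.
  by move=> xab; rewrite addr_ge0 ?subr_ge0 ?fmin ?fmin'// ?fin_max// fin_max'.
have qk := q0 kn.
have W0 : 0 < width k.
  pose c := (a + b) / 2.
  have cab : a < c < b by have := ab; rewrite /c; lra.
  have cab' : a <= c <= b by case/andP: cab => /ltW -> /ltW ->.
  have := hE c; have := eta0 c cab'; have := gam0 c cab'.
  have : 0 < q k * (be c - al c) by rewrite mulr_gt0// subr_gt0 al_lt_be.
  lra.
have aab : a <= a <= b by rewrite lexx ltW.
have bab : a <= b <= b by rewrite lexx ltW.
have etab : L b + L' b <= 0 by rewrite /L /L' (min_idPr bm) (min_idPr bm') !subrr addr0.
have gama : G a + G' a <= 0 by rewrite /G /G' (max_idPr am) (max_idPr am') !subrr addr0.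
have gamb : G b + G' b <= width k.
  have := hE b; have : 0 <= q k * (be b - al b).
    by rewrite mulr_ge0 ?subr_ge0 ?al_le_be// ltW.
  by have := eta0 b bab; lra.
have bmm g : continuous g -> bounded_measurable a b g by exact: continuous_bounded_measurable.
have bc (r : R) : bounded_measurable a b (fun=> r) by exact: bounded_measurable_cst.
have bmin g c : continuous g -> bounded_measurable a b (fun x => g (Num.min x c) - g c).
  move=> cg; apply: bounded_measurableB; last exact: bounded_measurable_cst.
  exact/continuous_bounded_measurable/continuous_comp_min.
have bmax g c : continuous g -> bounded_measurable a b (fun x => g (Num.max x c) - g c).
  move=> cg; apply: bounded_measurableB; last exact: bounded_measurable_cst.
  exact/continuous_bounded_measurable/continuous_comp_max.
have := @convex_pair_moment_le R a b (width k) (fun x => L x + L' x)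
  (fun x => G x + G' x) ab W0
  (bounded_measurableD (bmin _ _ (@cont_f k)) (bmin _ _ (@cont_f' k)))
  (bounded_measurableD (bmax _ _ (@cont_f k)) (bmax _ _ (@cont_f' k)))
  (convex_onD (convex_on_left_part (cf kn) am bm fmin)
     (convex_on_left_part (cf' kn) am' bm' fmin'))
  (convex_onD (convex_on_right_part (cf kn) am bm fmin)
     (convex_on_right_part (cf' kn) am' bm' fmin'))
  eta0 gam0 etab gama gamb.
have bk : bounded_measurable a b (fun x => be x - al x).
  by apply: bounded_measurableB; exact: continuous_bounded_measurable.
have buk : bounded_measurable a b (fun x => (b - x) * (be x - al x)).
  apply: bounded_measurableM => //; apply: bounded_measurableB.
    exact: bounded_measurable_cst.
  exact: bounded_measurable_id.
have -> : itv_integral a b (fun x => (b - x) * (width k - (L x + L' x) - (G x + G' x)))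
    = q k * Iuk.
  by rewrite -itv_integralZ//; apply: eq_itv_integral => x _; rewrite hE; ring.
have -> : itv_integral a b (fun x => width k - (L x + L' x) - (G x + G' x)) = q k * Ik.
  by rewrite -itv_integralZ//; apply: eq_itv_integral => x _; rewrite hE.
have -> : itv_integral a b (fun x => width k - (L x + L' x) + (G x + G' x))
    = itv_integral a b (left_variation k).
  by apply: eq_itv_integral => x _; exact: PE.
move=> H.
rewrite -(ler_pM2l qk); apply: le_trans (le_trans _ H) _; rewrite le_eqVlt; apply/orP;
  left; apply/eqP; ring.
Qed.

(** Summed over the directions of the zonogon, the moment inequalities bound the
    first moment of the boundary length by that of the area. *)
Lemma frame_length_moment (r : R) (P : R -> R) : 0 < Ik ->
  bounded_measurable a b P -> (forall t, a <= t <= b -> (P t)%:E = left_length t) ->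
  0 <= Iuk / Ik - (b - a) / 6 -> hausdorff1 frame = r%:E ->
  r * (Iuk / Ik - (b - a) / 6) <= (1 + e) * itv_integral a b P.
Proof.
move=> Ik0 bP PE C0 rE.
have rW : r <= 2 * \sum_(k < n) width k.
  by rewrite -lee_fin -rE; exact: hausdorff1_frame_le.
apply: le_trans (ler_wpM2r C0 rW) _.
rewrite -itv_integralZ//.
have le1 : itv_integral a b (fun t => \sum_(k < n) left_variation k t) <=
    itv_integral a b (fun t => (1 + e) * P t).
  apply: le_itv_integral_co.
  - exact: bounded_measurable_sum.
  - exact: bounded_measurableZ.
  - move=> t at_ tb; have tab : a <= t <= b by rewrite at_ ltW.
    rewrite -lee_fin EFinM PE//; exact: sum_left_variation_le.
apply: le_trans le1; rewrite itv_integral_sum//.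
rewrite mulrAC mulr_sumr; apply: ler_sum => k _.
have := left_variation_moment (ltn_ord k).
rewrite -(@ler_pdivrMr _ Ik)// => H.
have -> : 2 * (Iuk / Ik - (b - a) / 6) * width k =
    2 * width k * Iuk / Ik - width k * (b - a) / 3 by field; lra.
by rewrite lerBlDr.
Qed.

End Directions.

Let Ik := itv_integral a b (fun x => be x - al x).
Let Iuk := itv_integral a b (fun x => (b - x) * (be x - al x)).

Let continuous_line (p q : R) (g : R -> R) : continuous g ->
  continuous (fun x => p * x + q * g x).
Proof.
move=> cg x; apply: cvgD; apply: cvgM; [exact: cvg_cst|exact: cvg_id|exact: cvg_cst|exact: cg].
Qed.

Let minimizers (p q : nat -> R) (g : R -> R) : continuous g ->
  exists m : nat -> R, forall k, a <= m k <= b /\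
    forall x, a <= x <= b -> p k * m k + q k * g (m k) <= p k * x + q k * g x.
Proof.
move=> cg; suff: forall k, exists c, a <= c <= b /\
    forall x, a <= x <= b -> p k * c + q k * g c <= p k * x + q k * g x.
  by move=> /choice[m mP]; exists m.
move=> k; have [|c + h] := @EVT_min R (fun x => p k * x + q k * g x) a b (ltW ab).
  exact/continuous_subspaceT/continuous_line.
by rewrite in_itv/= => cab; exists c; split => // x xab; apply: h; rewrite in_itv.
Qed.

Lemma hausdorff1_frame_fin : hausdorff1 frame \is a fin_num.
Proof.
have [n [p [q [q0 zono]]]] := zonogon_norm (@ltr01 R).
have [m mP] := minimizers p q cal.
have [m' mP'] := minimizers (fun k => - p k) (fun k => - q k) cbe.
rewrite ge0_fin_numE ?hausdorff1_ge0//.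
apply: le_lt_trans (hausdorff1_frame_le (m := m) (m' := m') q0 zono _ _ _ _) _.
- by move=> k _; case: (mP k).
- by move=> k x _ xab; exact: (mP k).2.
- by move=> k _; case: (mP' k).
- by move=> k x _ xab; exact: (mP' k).2.
- exact: ltry.
Qed.

Let left_length_fin t : left_length t \is a fin_num.
Proof.
rewrite ge0_fin_numE ?hausdorff1_ge0//.
apply: le_lt_trans (hausdorff1S (@subIsetl _ _ _)) _.
by rewrite -ge0_fin_numE ?hausdorff1_ge0// hausdorff1_frame_fin.
Qed.

Let P t := fine (left_length t).

Let bounded_measurable_P : bounded_measurable a b P.
Proof.
split.
  apply: nondecreasing_measurable => // s t st; rewrite fine_le//.
  by apply: hausdorff1S => v [Fv /= vs]; split => //=; exact: le_trans st.
exists (fine (hausdorff1 frame)) => t _; rewrite ger0_norm ?fine_ge0 ?hausdorff1_ge0//.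
by rewrite fine_le// ?hausdorff1_frame_fin//; exact: hausdorff1S (@subIsetl _ _ _).
Qed.

(** The relative error of the zonogon tends to 0. *)
Let frame_moment : 0 < Ik ->
  fine (hausdorff1 frame) * (Iuk / Ik - (b - a) / 6) <= itv_integral a b P.
Proof.
move=> Ik0; have IP0 : 0 <= itv_integral a b P.
  by apply: itv_integral_ge0 => x _; rewrite fine_ge0// hausdorff1_ge0.
have [C0|C0] := leP 0 (Iuk / Ik - (b - a) / 6); last first.
  apply: le_trans IP0; rewrite mulr_ge0_le0 ?fine_ge0 ?hausdorff1_ge0//.
  exact: ltW.
apply/ler_addgt0Pr => eps eps0.
pose e := eps / (itv_integral a b P + 1).
have e0 : 0 < e by rewrite divr_gt0// ltr_wpDl.
have [n [p [q [q0 zono]]]] := zonogon_norm e0.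
have [m mP] := minimizers p q cal.
have [m' mP'] := minimizers (fun k => - p k) (fun k => - q k) cbe.
have := @frame_length_moment e n p q m m' e0 q0 zono _ _ _ _
  (fine (hausdorff1 frame)) P Ik0 bounded_measurable_P _ C0 _.
move=> H; apply: le_trans (H _ _ _ _ _ _) _.
- by move=> k _; case: (mP k).
- by move=> k x _ xab; exact: (mP k).2.
- by move=> k _; case: (mP' k).
- by move=> k x _ xab; exact: (mP' k).2.
- by move=> t _; rewrite fineK.
- by rewrite fineK// hausdorff1_frame_fin.
- rewrite mulrDl mul1r lerD2l /e mulrAC ler_pdivrMr ?ltr_wpDl//.
  by rewrite ler_pM2l// lerDl.
Qed.

Let bounded_measurable_section : bounded_measurable a b (fun x => be x - al x).
Proof. by apply: bounded_measurableB; exact: continuous_bounded_measurable. Qed.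

Let bounded_measurable_section_moment :
  bounded_measurable a b (fun x => (b - x) * (be x - al x)).
Proof.
apply: bounded_measurableM => //; apply: bounded_measurableB.
  exact: bounded_measurable_cst.
exact: bounded_measurable_id.
Qed.

(** The length of the vertical sections is concave, hence at least a parabola
    vanishing at both ends. *)
Let Ik_gt0 : 0 < Ik.
Proof.
have ab' := ab; pose c := (a + b) / 2; pose k x := be x - al x.
have kc : 0 < k c by rewrite subr_gt0 al_lt_be// /c; lra.
have k0 x : a <= x <= b -> 0 <= k x by move=> xab; rewrite subr_ge0 al_le_be.
have w0 : 0 < b - a by rewrite subr_gt0.
pose r := k c * 2 / (b - a) ^+ 2.
have r0 : 0 < r by rewrite divr_gt0 ?exprn_gt0// mulr_gt0.
have bq : bounded_measurable a b (fun x => - (a * b) + (a + b) * x + (-1) * x ^+ 2).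
  apply: continuous_bounded_measurable => x.
  apply: cvgD; last by apply: cvgM; [exact: cvg_cst|exact: exprn_continuous].
  by apply: cvgD; [exact: cvg_cst|apply: cvgM; [exact: cvg_cst|exact: cvg_id]].
have : itv_integral a b (fun x => r * (- (a * b) + (a + b) * x + (-1) * x ^+ 2)) <= Ik.
  apply: le_itv_integral => //; first exact: bounded_measurableZ.
  move=> x xab; have /andP[ax xb] := xab.
  have ka : 0 <= k a by rewrite k0// lexx ltW.
  have kb : 0 <= k b by rewrite k0// lexx ltW.
  have ac : a <= c by rewrite /c; lra.
  have cb : c <= b by rewrite /c; lra.
  have -> : r * (- (a * b) + (a + b) * x + -1 * x ^+ 2) =
    2 * k c * ((x - a) * (b - x)) / (b - a) ^+ 2 by rewrite /r; field; lra.
  rewrite ler_pdivrMr ?exprn_gt0// -/(k x).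
  have [xc|/ltW cx] := leP x c.
    have h1 := xal (lexx a) ax xc cb; have h2 := xbe (lexx a) ax xc cb.
    have h3 : (x - a) * k c <= (c - a) * k x.
      have : 0 <= (c - x) * k a by rewrite mulr_ge0// subr_ge0.
      by move: h1 h2; rewrite /k; lra.
    have h4 : (x - a) * k c * (b - x) <= (c - a) * k x * (b - a).
      apply: ler_pM => //; last exact: lerB.
        by rewrite mulr_ge0 ?(ltW kc)// subr_ge0.
      by rewrite subr_ge0.
    by rewrite expr2; move: h4; rewrite {1 2 3}/c; lra.
  have h1 := xal ac cx xb (lexx b); have h2 := xbe ac cx xb (lexx b).
  have h3 : (b - x) * k c <= (b - c) * k x.
    have : 0 <= (x - c) * k b by rewrite mulr_ge0// subr_ge0.
    by move: h1 h2; rewrite /k; lra.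
  have h4 : (b - x) * k c * (x - a) <= (b - c) * k x * (b - a).
    apply: ler_pM => //; last exact: lerB.
      by rewrite mulr_ge0 ?(ltW kc)// subr_ge0.
    by rewrite subr_ge0.
  by rewrite expr2; move: h4; rewrite /c; lra.
apply: lt_le_trans; rewrite itv_integralZ// itv_integral_quadratic// mulr_gt0//.
have -> : - (a * b) * b + (a + b) * (b ^+ 2 / 2) + -1 * (b ^+ 3 / 3) -
  (- (a * b) * a + (a + b) * (a ^+ 2 / 2) + -1 * (a ^+ 3 / 3)) = (b - a) ^+ 3 / 6.
  by field.
by rewrite divr_gt0// exprn_gt0.
Qed.

Let xsection_region x : xsection region x =
  if a <= x <= b then `[al x, be x]%classic else set0.
Proof.
apply/seteqP; split => y; rewrite xsectionP /region /= => h.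
  by case: h => -> h; rewrite /= in_itv.
by move: h; case: ifP => // xab; rewrite /= in_itv.
Qed.

Let lebesgue_section x : a <= x <= b ->
  lebesgue_measure (`[al x, be x]%classic : set (measurableTypeR R)) = (be x - al x)%:E.
Proof.
move=> xab; rewrite lebesgue_measure_itv/= lte_fin.
by have := al_le_be xab; case: ltgtP => // -> _; rewrite subrr.
Qed.

Let EFin_itv_integral f : bounded_measurable a b f ->
  (itv_integral a b f)%:E = (\int[lebesgue_measure]_(x in `[a, b]) (f x)%:E)%E.
Proof.
by move=> bf; rewrite /itv_integral /Rintegral fineK//;
  apply: integrable_fin_num => //; exact: bounded_measurable_integrable.
Qed.

Lemma area_region : area region = Ik%:E.
Proof.
rewrite EFin_itv_integral// integral_mkcond.
rewrite /area /product_measure1; apply: eq_integral => x _ /=.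
rewrite xsection_region /patch mem_setE in_itv/=; case: ifP => xab.
  exact: lebesgue_section.
exact: measure0.
Qed.

Let integral_area_region :
  (\int[@area R]_(v in region) (b - v.1)%:E = Iuk%:E)%E.
Proof.
have mf : measurable_fun setT
    ((fun v : mplane R => (b - v.1)%:E) \_ region : mplane R -> \bar R).
  apply/(measurable_restrictT _ measurable_region)/measurable_EFinP.
  apply: measurable_funTS; apply: measurable_funB => //.
have f0 v : (0 <= ((fun v : mplane R => (b - v.1)%:E) \_ region) v)%E.
  rewrite /patch; case: ifPn => // /set_mem[/andP[_ vb] _].
  by rewrite lee_fin subr_ge0.
rewrite integral_mkcond /area (fubini_tonelli1 _ mf f0).
rewrite EFin_itv_integral// [RHS]integral_mkcond.
apply: eq_integral => x _; rewrite /fubini_F.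
transitivity (\int[lebesgue_measure]_(y in xsection region x) (b - x)%:E)%E.
  rewrite [RHS]integral_mkcond; apply: eq_integral => y _.
  by rewrite /patch mem_xsection.
rewrite integral_cst; last exact: measurable_xsection measurable_region.
rewrite xsection_region /patch mem_setE in_itv/=; case: ifP => xab.
  by rewrite [X in (_ * X)%E]lebesgue_section// -EFinM.
by rewrite measure0 mule0.
Qed.

Let frame_fst v : frame v -> a <= v.1 <= b.
Proof. by case=> -[]. Qed.

(** The upper and the lower boundary both project onto [[a, b]]. *)
Lemma hausdorff1_frame_ge : ((2 * (b - a))%:E <= hausdorff1 frame)%E.
Proof.
have ge g : ((b - a)%:E <= hausdorff1 (graph_over g `]a, b[))%E.
  apply: (@hausdorff1_ge_image _ _ (fun v : plane R => v.1)).
    by move=> v w; exact: (ler_fst_enorm (v - w)).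
  by move=> t tab; exists (t, g t).
have mg g : continuous g -> @measurable _ (mplane R) (graph_over g `]a, b[).
  move=> cg; rewrite (_ : graph_over g _ = (`]a, b[ `*` setT) `&`
      [set v | v.2 = g v.1]).
    apply: measurableI; first exact: measurableX.
    by apply: measurable_eq => //; exact: measurable_left.
  by apply/seteqP; split => v /=; [move=> []|move=> [[]]].
rewrite mulr_natl mulr2n EFinD; apply: le_trans (leeD (ge al) (ge be)) _.
rewrite -[hausdorff1 (graph_over al _)]/(borel_hausdorff1 _).
rewrite -[hausdorff1 (graph_over be _)]/(borel_hausdorff1 _).
rewrite -measureU//; [|exact: mg..|]; last first.
  apply/seteqP; split => // v [[/= + v2] [/= _ v2']].
  rewrite in_itv/= => /al_lt_be.
  by rewrite -v2 -v2' ltxx.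
apply: (@hausdorff1S R _ frame) => v [] [/=]; rewrite in_itv/= => vab v2.
  have vab' : a <= v.1 <= b by case/andP: vab => /ltW -> /ltW ->.
  by rewrite /frame /region /= vab' v2 lexx al_le_be//; split => //; right; right; left.
have vab' : a <= v.1 <= b by case/andP: vab => /ltW -> /ltW ->.
by rewrite /frame /region /= vab' v2 lexx al_le_be//; split => //; right; right; right.
Qed.

Let L := fine (hausdorff1 frame).

Let L_gt0 : 0 < L.
Proof.
have ab' := ab; have := hausdorff1_frame_ge.
rewrite -(fineK hausdorff1_frame_fin) lee_fin -/L; lra.
Qed.

Let frame_lty : (borel_hausdorff1 frame < +oo)%E.
Proof. by rewrite -ge0_fin_numE ?measure_ge0//; exact: hausdorff1_frame_fin. Qed.

Let integral_hausdorff1_frame :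
  (\int[@borel_hausdorff1 R]_(v in frame) (b - v.1)%:E = (itv_integral a b P)%:E)%E.
Proof.
rewrite (layer_cake measurable_frame frame_lty mfst frame_fst).
rewrite EFin_itv_integral//; apply: eq_integral => t _.
by rewrite /P fineK.
Qed.

(** Passes from the moment of [b - v.1], which is nonnegative, to the center. *)
Let moment_complement (mu : {measure set (mplane R) -> \bar R}) (D : set (mplane R)) (r : R) :
  measurable D -> (forall v, D v -> a <= v.1 <= b) -> mu D \is a fin_num ->
  0 < fine (mu D) ->
  (\int[mu]_(v in D) (b - v.1)%:E = r%:E)%E ->
  (fine (mu D))^-1 * fine (\int[mu]_(v in D) (v.1)%:E)%E = b - r / fine (mu D).
Proof.
move=> mD Dab muD muD0 E.
have muDoo : (mu D < +oo)%E by rewrite -ge0_fin_numE ?measure_ge0.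
have i1 : mu.-integrable D (EFin \o (fun v : mplane R => v.1 : R)).
  apply: measurable_bounded_integrable => //; first exact: measurable_funTS.
  exists (`|a| + `|b|); split; first exact: num_real.
  move=> N MN v /= /Dab /andP[av vb]; apply: le_trans (ltW MN).
  rewrite ler_norml; move: av vb.
  have := ler_norm a; have := ler_norm (- a); rewrite normrN.
  have := ler_norm b; have := ler_norm (- b); rewrite normrN.
  by have := normr_ge0 a; have := normr_ge0 b; lra.
have ib : mu.-integrable D (EFin \o (fun=> b)).
  by apply: measurable_bounded_integrable => //; exact: bounded_cst.
have := @RintegralB _ _ _ mu D (fun=> b) (fun v : mplane R => v.1 : R) mD ib i1.
rewrite Rintegral_cst// {1}/Rintegral E/= => rE.
have -> : fine (\int[mu]_(v in D) (v.1)%:E)%E = b * fine (mu D) - r.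
  by rewrite rE /Rintegral; ring.
by field; rewrite gt_eqF.
Qed.

(** By [moment_complement] both centers are at the left of [b], at distances that
    [frame_moment] compares. *)
Lemma centers_fst_le :
  (center_of_mass (@hausdorff1 R) frame).1 - (center_of_mass (@area R) region).1
    <= (b - a) / 6.
Proof.
have regE : fine (area region) = Ik by rewrite area_region.
have E1 : (fine (hausdorff1 frame))^-1 *
    fine (\int[(@hausdorff1 R : set (mplane R) -> \bar R)]_(v in frame) (v.1)%:E)%E = b - itv_integral a b P / L :=
  @moment_complement (@borel_hausdorff1 R) frame (itv_integral a b P)
  measurable_frame frame_fst hausdorff1_frame_fin L_gt0 integral_hausdorff1_frame.
have reg0 : 0 < fine (area region) by rewrite regE; exact: Ik_gt0.
have regf : area region \is a fin_num by rewrite area_region.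
have regab v : region v -> a <= v.1 <= b by case.
have E2 : (fine (area region))^-1 * fine (\int[@area R]_(v in region) (v.1)%:E)%E
    = b - Iuk / fine (area region) :=
  @moment_complement (@lebesgue_measure R \x @lebesgue_measure R)%E region Iuk
  measurable_region regab regf reg0 integral_area_region.
rewrite /center_of_mass/= E1 E2 regE.
have := frame_moment Ik_gt0; rewrite -/L mulrC -ler_pdivlMr ?L_gt0//; lra.
Qed.

End Body.

(** * Convex bodies are such regions *)

Section ConvexBody.
Variable R : realType.
Implicit Types (K : set (plane R)) (v w : plane R).

Definition plane_convex K := forall v w (t : R), K v -> K w -> 0 <= t <= 1 ->
  K (t * v.1 + (1 - t) * w.1, t * v.2 + (1 - t) * w.2).

Lemma convex_set_plane K :
  convex_set (K : set (convex_lmodType (plane R))) -> plane_convex K.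
Proof.
move=> cK v w t Kv Kw /andP[t0 t1].
have := cK v w (Itv01 t0 t1); rewrite !inE => /(_ Kv Kw).
by rewrite /conv/=.
Qed.

Lemma continuous_fst_plane : continuous (fun v : plane R => v.1 : R).
Proof. by move=> v; exact: cvg_fst. Qed.

Lemma continuous_snd_plane : continuous (fun v : plane R => v.2 : R).
Proof. by move=> v; exact: cvg_snd. Qed.

Lemma compact_plane_min (f : plane R -> R) K : K !=set0 -> compact K -> continuous f ->
  exists2 v, K v & forall w, K w -> f v <= f w.
Proof.
move=> K0 cK cf; have [|v] := @compact_EVT_min _ R f K K0 cK.
  exact: continuous_subspaceT.
by rewrite inE => Kv h; exists v => // w Kw; apply: h; rewrite inE.
Qed.

Lemma closed_le_plane (f : plane R -> R) (r : R) : continuous f -> closed [set v | f v <= r].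
Proof.
move=> cf; rewrite (_ : [set v | _] = f @^-1` [set t | t <= r])//.
by apply: closed_comp => //; exact: closed_le.
Qed.

Lemma compact_plane_closed K : compact K -> closed K.
Proof. by apply: compact_closed; exact: (@norm_hausdorff _ (plane R)). Qed.

Section Lower.
Variables (K : set (plane R)) (a b s : R).
Hypotheses (cK : compact K) (xK : plane_convex K) (ab : a < b) (s2 : s * s = 1).
Hypothesis Kab : forall v, K v -> a <= v.1 <= b.
Hypotheses (Ka : exists y, K (a, y)) (Kb : exists y, K (b, y)).

Let csnd : continuous (fun v : plane R => s * v.2).
Proof. by move=> v; apply: cvgM; [exact: cvg_cst|exact: continuous_snd_plane]. Qed.

Let slice x : a <= x <= b -> exists y, K (x, y).
Proof.
move=> /andP[ax xb]; have [ya Kya] := Ka; have [yb Kyb] := Kb.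
have w0 : 0 < b - a by rewrite subr_gt0.
have t01 : 0 <= (b - x) / (b - a) <= 1.
  rewrite divr_ge0 ?subr_ge0//; last exact: ltW.
  by rewrite ler_pdivrMr// mul1r lerB.
have := xK Kya Kyb t01; rewrite /= (_ : _ * a + _ = x) => [h|]; first by eexists; exact: h.
by field; rewrite subr_eq0 gt_eqF.
Qed.

Let clamp (x : R) := Num.max a (Num.min x b).

Let clamp_in x : a <= clamp x <= b.
Proof. by rewrite le_max lexx ge_max ge_min lexx orbT (ltW ab). Qed.

Let clamp_id x : a <= x <= b -> clamp x = x.
Proof. by move=> /andP[ax xb]; rewrite /clamp (min_idPl xb) (max_idPr ax). Qed.

Let continuous_clamp : continuous clamp.
Proof.
move=> x; apply: (@continuous_max _ R (fun=> a) (fun x => Num.min x b)).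
  exact: cvg_cst.
by apply: (@continuous_min _ R id (fun=> b)); [exact: cvg_id|exact: cvg_cst].
Qed.

Let compactI (D : set (plane R)) : closed D -> compact (K `&` D).
Proof.
move=> cD; apply: (subclosed_compact _ cK); last exact: subIsetl.
by apply: closedI => //; exact: compact_plane_closed.
Qed.

(** The extremal ordinate over each abscissa in the direction [s = 1] or [s = -1].
    Its sublevel sets are projections of compact sets, which makes it lower
    semicontinuous up to the end points; convexity bounds it from above. *)
Lemma lower_boundary : exists g : R -> R, [/\ continuous g, convex_on a b g,
  forall x, a <= x <= b -> K (x, s * g x) &
  forall x y, K (x, y) -> g x <= s * y].
Proof.
have /choice[g0 g0P] : forall x, exists y, a <= x <= b ->
    K (x, s * y) /\ forall y', K (x, y') -> y <= s * y'.
  move=> x; have [xab|] := boolP (a <= x <= b); last by exists 0.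
  have [|||v [Kv /andP[v1 v2]] vmin] := @compact_plane_min (fun v => s * v.2)
      (K `&` [set v | x <= v.1 <= x]).
  - by have [y Ky] := slice xab; exists (x, y); split => //=; rewrite lexx.
  - apply: compactI; rewrite (_ : [set v | _] = [set v | v.1 <= x] `&` [set v | - v.1 <= - x]).
      apply: closedI; apply: closed_le_plane; first exact: continuous_fst_plane.
      by move=> v; apply: cvgN; exact: continuous_fst_plane.
    apply/seteqP; split => v /=; rewrite lerN2; first by move=> /andP[].
    by move=> [-> ->].
  - exact: csnd.
  exists (s * v.2) => _; have v1x : v.1 = x by apply/eqP; rewrite eq_le v1 v2.
  rewrite mulrA s2 mul1r -{1}v1x -surjective_pairing; split => // y' Ky'.
  by apply: (vmin (x, y')); split => //=; rewrite lexx.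
have Kg x : a <= x <= b -> K (x, s * g0 x) by move=> /g0P[].
have gm x y : K (x, y) -> g0 x <= s * y.
  by move=> Kxy; have /g0P[_] := Kab Kxy; exact.
have cvx : convex_on a b g0.
  move=> x y z ax xy yz zb.
  have [xz|xz] := eqVneq x z.
    have xyE : y = x by apply/eqP; rewrite eq_le xy xz yz.
    by rewrite xyE -xz !subrr !mul0r addr0.
  have {}xz : x < z by rewrite lt_neqAle xz (le_trans xy yz).
  have z0 : 0 < z - x by rewrite subr_gt0.
  have Kx : K (x, s * g0 x) by apply: Kg; rewrite ax (le_trans (ltW xz)).
  have Kz : K (z, s * g0 z) by apply: Kg; rewrite zb (le_trans ax (ltW xz)).
  have t01 : 0 <= (z - y) / (z - x) <= 1.
    rewrite divr_ge0 ?subr_ge0//; last exact: ltW.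
    by rewrite ler_pdivrMr// mul1r lerB.
  have := xK Kx Kz t01; rewrite /= (_ : _ * x + _ = y); last first.
    by field; rewrite subr_eq0 gt_eqF.
  move=> /gm; rewrite -(ler_pM2l z0) => h; apply: le_trans h _.
  rewrite le_eqVlt; apply/orP; left; apply/eqP.
  transitivity ((s * s) * ((z - y) * g0 x + (y - x) * g0 z)); last by rewrite s2 mul1r.
  by field; rewrite subr_eq0 gt_eqF.
have [D D0 gD] : exists2 D, 0 < D & forall x y, a <= x <= b -> a <= y <= b -> g0 x - g0 y < D.
  have K0 : K !=set0 by have [y Ky] := Ka; exists (a, y).
  have [v1 _ m1] := compact_plane_min K0 cK csnd.
  have [|v2 _ m2] := @compact_plane_min (fun v => - (s * v.2)) K K0 cK.
    by move=> v; apply: cvgN; exact: csnd.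
  exists (`|s * v2.2 - s * v1.2| + 1); first by rewrite ltr_wpDl.
  move=> x y xab yab; apply: (@le_lt_trans _ _ (s * v2.2 - s * v1.2)).
    have := m1 _ (Kg y yab); have := m2 _ (Kg x xab).
    by rewrite /= !mulrA s2 !mul1r; lra.
  by rewrite ltr_pwDr// ler_norm.
have upper (x0 e : R) : a <= x0 <= b -> 0 < e -> exists2 d : R, 0 < d &
    forall x, a <= x <= b -> `|x - x0| < d -> g0 x < g0 x0 + e.
  move=> x0ab e0; have /andP[ax0 x0b] := x0ab.
  (* The chords from x0 to the end points have slopes bounded in terms of the
     distance to the end points, unless x0 is itself an end point. *)
  pose dr := if x0 < b then e * (b - x0) / D else 1.
  pose dl := if a < x0 then e * (x0 - a) / D else 1.
  have dr0 : 0 < dr.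
    by rewrite /dr; case: ifP => // h; rewrite divr_gt0// mulr_gt0// subr_gt0.
  have dl0 : 0 < dl.
    by rewrite /dl; case: ifP => // h; rewrite divr_gt0// mulr_gt0// subr_gt0.
  exists (Num.min dr dl); first by rewrite lt_min dr0.
  move=> x xab; have /andP[ax xb] := xab; rewrite lt_min => /andP[xr xl].
  have [xx0|x0x|->] := ltgtP x x0; last by rewrite ltrDl.
    have ax0' : a < x0 by exact: le_lt_trans ax xx0.
    move: xl; rewrite /dl ax0' ltr_pdivlMr// ltr0_norm ?subr_lt0// opprB => xl.
    have := cvx a x x0 (lexx a) ax (ltW xx0) x0b.
    have := gD a x0 _ x0ab; rewrite lexx (ltW ab) => /(_ isT) h1 h2.
    have h3 : (x0 - x) * (g0 a - g0 x0) <= (x0 - x) * D.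
      by rewrite ler_wpM2l ?ltW// subr_gt0.
    rewrite -subr_gt0 -(@pmulr_rgt0 _ (x0 - a)) ?subr_gt0//.
    by move: h2 h3 xl; lra.
  have x0b' : x0 < b by exact: lt_le_trans x0x xb.
  move: xr; rewrite /dr x0b' ltr_pdivlMr// gtr0_norm ?subr_gt0// => xr.
  have := cvx x0 x b ax0 (ltW x0x) xb (lexx b).
  have := gD b x0 _ x0ab; rewrite lexx (ltW ab) => /(_ isT) h1 h2.
  have h3 : (x - x0) * (g0 b - g0 x0) <= (x - x0) * D.
    by rewrite ler_wpM2l ?ltW// subr_gt0.
  rewrite -subr_gt0 -(@pmulr_rgt0 _ (b - x0)) ?subr_gt0//.
  by move: h2 h3 xr; lra.
have lower (x0 e : R) : a <= x0 <= b -> 0 < e -> exists2 d : R, 0 < d &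
    forall x, a <= x <= b -> `|x - x0| < d -> g0 x0 - e < g0 x.
  move=> x0ab e0.
  pose S : set R := fst @` (K `&` [set v | s * v.2 <= g0 x0 - e]).
  have cS : closed S.
    apply: compact_closed; first exact: (@norm_hausdorff _ R^o).
    apply: continuous_compact.
      by apply: continuous_subspaceT; exact: continuous_fst_plane.
    by apply: compactI; exact: closed_le_plane.
  have nS : ~ S x0.
    move=> [[x y] [Kxy /= h] /= xE]; rewrite xE in Kxy.
    by have := le_trans (gm _ _ Kxy) h; rewrite lerDl oppr_ge0 leNgt e0.
  have : nbhs x0 (~` S) by apply: open_nbhs_nbhs; split => //; exact: closed_openC.
  move=> /nbhs_ballP[d /= d0 dS]; exists d => // x xab xd.
  rewrite ltNge; apply/negP => gx; apply: (dS x).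
    by rewrite /ball/= distrC.
  exists (x, s * g0 x) => //; split => /=; first exact: Kg.
  by rewrite mulrA s2 mul1r.
exists (g0 \o clamp); split.
- move=> x; apply/cvgrPdist_lt => e e0.
  have [d1 d10 h1] := upper (clamp x) e (clamp_in x) e0.
  have [d2 d20 h2] := lower (clamp x) e (clamp_in x) e0.
  have /cvgrPdist_lt cx := @continuous_clamp x.
  near=> t; rewrite /= ltr_distlC.
  have td1 : `|clamp t - clamp x| < d1.
    by rewrite distrC; near: t; exact: cx.
  have td2 : `|clamp t - clamp x| < d2.
    by rewrite distrC; near: t; exact: cx.
  by rewrite (h2 _ (clamp_in t) td2) (h1 _ (clamp_in t) td1).
- move=> x y z ax xy yz zb.
  have xab : a <= x <= b by rewrite ax (le_trans xy (le_trans yz zb)).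
  have yab : a <= y <= b by rewrite (le_trans ax xy) (le_trans yz zb).
  have zab : a <= z <= b by rewrite zb (le_trans ax (le_trans xy yz)).
  by rewrite /= !clamp_id//; exact: cvx.
- by move=> x xab; rewrite /= clamp_id//; exact: Kg.
- by move=> x y Kxy; rewrite /= clamp_id; [exact: gm|exact: Kab Kxy].
Unshelve. all: by end_near. Qed.

End Lower.

Lemma nbhs_plane_box K v : nbhs v K -> exists2 r : R, 0 < r &
  forall w : plane R, `|v.1 - w.1| < r -> `|v.2 - w.2| < r -> K w.
Proof.
by move=> /nbhs_ballP[r /= r0 rK]; exists r => // w h1 h2; apply: rK; split.
Qed.

(** The two functions are the lower and the upper boundary; since they are continuous,
    a point is interior as soon as it satisfies the four inequalities strictly. *)
Lemma convex_body_region K : compact K -> plane_convex K -> K° !=set0 ->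
  exists a b (al be : R -> R),
  [/\ a < b, continuous al /\ continuous be,
      convex_on a b al /\ convex_on a b (fun x => - be x),
      (forall x, a <= x <= b -> al x <= be x) /\
        (forall x, a < x < b -> al x < be x) &
      [/\ K = region a b al be, boundary K = frame a b al be,
        exists2 v, K v & v.1 = a & exists2 v, K v & v.1 = b]].
Proof.
move=> cK xK [v0 Kv0].
have K0 : K !=set0 by exists v0; exact: interior_subset.
have [va Kva va_min] := compact_plane_min K0 cK continuous_fst_plane.
have [|vb Kvb vb_max] := @compact_plane_min (fun v => - v.1) K K0 cK.
  by move=> v; apply: cvgN; exact: continuous_fst_plane.
pose a := va.1; pose b := vb.1.
have Kab v : K v -> a <= v.1 <= b.
  by move=> Kv; rewrite va_min//= -lerN2 vb_max.
have intK v : K° v -> [/\ a < v.1, v.1 < b, exists2 y, K (v.1, y) & y < v.2 &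
    exists2 y, K (v.1, y) & v.2 < y].
  move=> /nbhs_plane_box[r r0 rK].
  have r2 : `|r / 2| < r by rewrite ger0_norm; lra.
  have box s t : `|s| < r -> `|t| < r -> K (v.1 + s, v.2 + t).
    by move=> sr tr; apply: rK; rewrite /= opprD addNKr normrN.
  have n0 : `|0 : R| < r by rewrite normr0.
  have nr2 : `|- (r / 2)| < r by rewrite normrN.
  split.
  - have /andP[/= h _] := Kab _ (box _ _ nr2 n0); lra.
  - have /andP[_ /= h] := Kab _ (box _ _ r2 n0); lra.
  - by exists (v.2 - r / 2); [rewrite -{1}(addr0 v.1); exact: box|lra].
  - by exists (v.2 + r / 2); [rewrite -{1}(addr0 v.1); exact: box|lra].
have [av0 v0b [y1 Ky1 y1v] [y2 Ky2 vy2]] := intK _ Kv0.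
have ab : a < b := lt_trans av0 v0b.
have Ka : exists y, K (a, y) by exists va.2; rewrite -surjective_pairing.
have Kb : exists y, K (b, y) by exists vb.2; rewrite -surjective_pairing.
have [|al [cal xal Kal al_min]] := @lower_boundary K a b 1 cK xK ab _ Kab Ka Kb.
  by rewrite mulr1.
have [|be' [cbe' xbe' Kbe' be_max']] := @lower_boundary K a b (-1) cK xK ab _ Kab Ka Kb.
  by rewrite mulrNN mulr1.
pose be x := - be' x.
have cbe : continuous be by move=> x; apply: cvgN; exact: cbe'.
have be_max x y : K (x, y) -> y <= be x.
  by move=> /be_max'; rewrite mulN1r /be; lra.
have Kbe x : a <= x <= b -> K (x, be x) by move=> /Kbe'; rewrite mulN1r.
have {}al_min x y : K (x, y) -> al x <= y by move=> /al_min; rewrite mul1r.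
have {}Kal x : a <= x <= b -> K (x, al x) by move=> /Kal; rewrite mul1r.
have xbe : convex_on a b (fun x => - be x).
  by move=> x y z ax xy yz zb; rewrite /be !opprK; exact: xbe'.
have al_be x : a <= x <= b -> al x <= be x by move=> /Kal /be_max.
have ltv0 : al v0.1 < be v0.1.
  by have := al_min _ _ Ky1; have := be_max _ _ Ky2; lra.
have aab : a <= a <= b by rewrite lexx ltW.
have bab : a <= b <= b by rewrite lexx ltW.
have al_lt x : a < x < b -> al x < be x.
  move=> /andP[ax xb]; rewrite -subr_gt0.
  have [xv|vx] := leP x v0.1.
    have h1 := xal a x v0.1 (lexx a) (ltW ax) xv (ltW v0b).
    have h2 := xbe a x v0.1 (lexx a) (ltW ax) xv (ltW v0b).
    have h3 : 0 <= (v0.1 - x) * (be a - al a) by rewrite mulr_ge0 ?subr_ge0 ?al_be.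
    have h4 : 0 < (x - a) * (be v0.1 - al v0.1) by rewrite mulr_gt0 ?subr_gt0.
    rewrite -(@pmulr_rgt0 _ (v0.1 - a)) ?subr_gt0//.
    by move: h1 h2 h3 h4; lra.
  have h1 := xal v0.1 x b (ltW av0) (ltW vx) (ltW xb) (lexx b).
  have h2 := xbe v0.1 x b (ltW av0) (ltW vx) (ltW xb) (lexx b).
  have h3 : 0 <= (x - v0.1) * (be b - al b).
    by rewrite mulr_ge0 ?subr_ge0 ?al_be// ltW.
  have h4 : 0 < (b - x) * (be v0.1 - al v0.1) by rewrite mulr_gt0 ?subr_gt0.
  rewrite -(@pmulr_rgt0 _ (b - v0.1)) ?subr_gt0//.
  by move: h1 h2 h3 h4; lra.
have KE : K = region a b al be.
  apply/seteqP; split => -[x y]; rewrite /region /=.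
    by move=> Kxy; rewrite (Kab _ Kxy) (al_min _ _ Kxy) (be_max _ _ Kxy).
  move=> [xab /andP[ay yb]].
  have [E|E] := eqVneq (al x) (be x).
    have -> : y = al x by apply/eqP; rewrite eq_le ay E yb.
    exact: Kal.
  have lt : 0 < be x - al x by rewrite subr_gt0 lt_neqAle E al_be.
  have t01 : 0 <= (be x - y) / (be x - al x) <= 1.
    rewrite divr_ge0 ?subr_ge0//; last exact: al_be.
    by rewrite ler_pdivrMr// mul1r lerB.
  have := xK _ _ _ (Kal x xab) (Kbe x xab) t01.
  rewrite /= (_ : _ * x + _ = x); last by ring.
  rewrite (_ : _ * al x + _ = y)//.
  by field; rewrite gt_eqF.
exists a, b, al, be; split => //; split => //; last 2 first.
- by exists va.
- by exists vb.
rewrite /boundary; have /closure_id <- := compact_plane_closed cK.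
have openK v : a < v.1 -> v.1 < b -> al v.1 < v.2 -> v.2 < be v.1 -> K° v.
  move=> av vb' alv vbe; rewrite /interior KE.
  have pos (h : plane R -> R) : continuous h -> 0 < h v -> \forall w \near v, 0 < h w.
    by move=> ch hv; have := cvgr_gt _ (ch v); exact.
  have c1 := continuous_fst_plane; have c2 := continuous_snd_plane.
  have cal1 : continuous (fun w : plane R => al w.1).
    by move=> w; apply: (@continuous_comp _ _ _ (fun w : plane R => w.1 : R) al); [exact: c1|exact: cal].
  have cbe1 : continuous (fun w : plane R => be w.1).
    by move=> w; apply: (@continuous_comp _ _ _ (fun w : plane R => w.1 : R) be); [exact: c1|exact: cbe].
  have sub (f g : plane R -> R) : continuous f -> continuous g -> f v < g v ->
      \forall w \near v, f w < g w.
    move=> cf cg fg; have : \forall w \near v, 0 < g w - f w.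
      apply: (pos (fun w => g w - f w)); last by rewrite subr_gt0.
      by move=> w; apply: cvgB; [exact: cg|exact: cf].
    by apply: filterS => w; rewrite subr_gt0.
  have ca : continuous (fun _ : plane R => a) by move=> w; exact: cvg_cst.
  have cb : continuous (fun _ : plane R => b) by move=> w; exact: cvg_cst.
  near=> w; rewrite /region /=; split; apply/andP; split; apply: ltW; near: w.
  - exact: (sub _ _ ca c1).
  - exact: (sub _ _ c1 cb).
  - exact: (sub _ _ cal1 c2).
  - exact: (sub _ _ c2 cbe1).
apply/seteqP; split => v.
  move=> [Kv nKv]; split; first by rewrite -KE.
  move: (Kv); rewrite KE => -[/andP[av vb'] /andP[alv vbe]].
  have [->|nva] := eqVneq v.1 a; first by left.
  have [->|nvb] := eqVneq v.1 b; first by right; left.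
  have [->|nval] := eqVneq v.2 (al v.1); first by right; right; left.
  have [->|nvbe] := eqVneq v.2 (be v.1); first by right; right; right.
  exfalso; apply: nKv; apply: openK; rewrite lt_neqAle ?av ?vb' ?alv ?vbe andbT//.
    by rewrite eq_sym.
  by rewrite eq_sym.
move=> [rv hv]; split; first by rewrite KE.
move=> /intK[av vb' [y1' /al_min k1 l1] [y2' /be_max k2 l2]].
case: hv => [h|[h|[h|h]]].
- by rewrite h ltxx in av.
- by rewrite h ltxx in vb'.
- by move: (le_lt_trans k1 l1); rewrite h ltxx.
- by move: (lt_le_trans l2 k2); rewrite h ltxx.
Unshelve. all: by end_near. Qed.

End ConvexBody.

(** * Rotations *)

Section Translation.
Variable R : realType.

Lemma lebesgue_measure_translate (c : R) (A : set (measurableTypeR R)) :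
  measurable A -> lebesgue_measure ((fun x => x + c) @^-1` A) = lebesgue_measure A.
Proof.
move=> mA.
have mT : measurable_fun setT (fun x : measurableTypeR R => x + c : measurableTypeR R).
  exact: measurable_funD.
apply/esym; apply: (lebesgue_measure_unique (mu := pushforward lebesgue_measure
  (fun x : measurableTypeR R => x + c : measurableTypeR R))) => //.
move=> _ [[x y]] _ <-.
transitivity (lebesgue_measure ((fun t : R => t + c) @^-1` `]x, y] : set (measurableTypeR R))); last by [].
rewrite (_ : _ @^-1` `]x, y] = `]x - c, y - c]%classic); last first.
  by apply/seteqP; split => t /=; rewrite !in_itv/= ltrBlDr lerBrDr.
rewrite !lebesgue_measure_itv/= !lte_fin ltrD2r.
by case: ifP => // _; rewrite -!EFinB opprB addrA subrK.
Qed.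

End Translation.

Section Shear.
Variable R : realType.
Local Open Scope ereal_scope.

Definition rotation (c s : R) (v : mplane R) : mplane R :=
  (c * v.1 + s * v.2, - s * v.1 + c * v.2)%R.

Let shear1 (m : R) (v : mplane R) : mplane R := (v.1 + m * v.2, v.2)%R.
Let shear2 (m : R) (v : mplane R) : mplane R := (v.1, v.2 + m * v.1)%R.

Let measurable_lin (p q : R) :
  measurable_fun setT (fun v : mplane R => p * v.1 + q * v.2 : measurableTypeR R)%R.
Proof.
by apply: measurable_funD; apply: measurable_funM.
Qed.

Lemma measurable_rotation c s : measurable_fun setT (rotation c s).
Proof. by apply/measurable_fun_pairP; split; exact: measurable_lin. Qed.

Let measurable_shear1 m : measurable_fun setT (shear1 m).
Proof.
apply/measurable_fun_pairP; split; last exact: measurable_snd.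
rewrite (_ : _ \o _ = fun v : mplane R => 1 * v.1 + m * v.2)%R; first exact: measurable_lin.
by apply/funext => v /=; rewrite mul1r.
Qed.

Let measurable_shear2 m : measurable_fun setT (shear2 m).
Proof.
apply/measurable_fun_pairP; split; first exact: measurable_fst.
rewrite (_ : _ \o _ = fun v : mplane R => m * v.1 + 1 * v.2)%R; first exact: measurable_lin.
by apply/funext => v /=; rewrite mul1r addrC.
Qed.

Let measurable_preimageT (f : mplane R -> mplane R) B : measurable_fun setT f ->
  measurable B -> measurable (f @^-1` B).
Proof. by move=> mf mB; rewrite -[X in measurable X]setTI; exact: mf. Qed.

Let area2 (B : set (mplane R)) : measurable B ->
  area B = (@lebesgue_measure R \x^ @lebesgue_measure R) B.
Proof.
move=> mB; apply: product_measure_unique => // A1 A2 mA1 mA2.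
exact: product_measure2E.
Qed.

Let area_shear1 m B : measurable B -> area (shear1 m @^-1` B) = area B.
Proof.
move=> mB; rewrite !area2//; last exact: measurable_preimageT.
rewrite /product_measure2; apply: eq_integral => y _ /=.
rewrite -[RHS](@lebesgue_measure_translate R (m * y)); last exact: measurable_ysection.
by congr lebesgue_measure; apply/seteqP; split => x /=; rewrite !ysectionP.
Qed.

Let area_shear2 m B : measurable B -> area (shear2 m @^-1` B) = area B.
Proof.
move=> mB; rewrite /area /product_measure1; apply: eq_integral => x _ /=.
rewrite -[RHS](@lebesgue_measure_translate R (m * x)); last exact: measurable_xsection.
by congr lebesgue_measure; apply/seteqP; split => y /=; rewrite !xsectionP.
Qed.

(** A rotation other than the half-turn is a product of three shears, which preserve
    the area by translation invariance on the line; the half-turn is the square of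
    a quarter-turn. *)
Lemma area_rotation c s B : (c ^+ 2 + s ^+ 2 = 1)%R -> measurable B ->
  area (rotation c s @^-1` B) = area B.
Proof.
move=> cs1.
have main c' s' C : (c' ^+ 2 + s' ^+ 2 = 1)%R -> (1 + c' != 0)%R -> measurable C ->
    area (rotation c' s' @^-1` C) = area C.
  move=> {}cs1 c1 mC; pose m := (s' / (1 + c'))%R.
  have mE : (1 - m * s' = c')%R.
    have -> : (1 - m * s' = (1 + c' - s' ^+ 2) / (1 + c'))%R by rewrite /m; field.
    have -> : (s' ^+ 2 = 1 - c' ^+ 2)%R by rewrite -cs1; ring.
    by field.
  have E : rotation c' s' =1 shear1 m \o shear2 (- s') \o shear1 m.
    move=> v; rewrite /rotation /shear1 /shear2 /=; congr pair.
      rewrite (_ : v.1 + m * v.2 + m * (v.2 + - s' * (v.1 + m * v.2)) =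
        (1 - m * s') * v.1 + (m * (1 - m * s') + m) * v.2)%R; last by ring.
      by rewrite mE; congr (_ * _ + _ * _)%R; rewrite /m; field.
    rewrite (_ : v.2 + - s' * (v.1 + m * v.2) =
      - s' * v.1 + (1 - m * s') * v.2)%R; last by ring.
    by rewrite mE.
  have -> : rotation c' s' @^-1` C = shear1 m @^-1` (shear2 (- s') @^-1` (shear1 m @^-1` C)).
    by apply/seteqP; split => v /=; rewrite E.
  by rewrite area_shear1 ?area_shear2 ?area_shear1//; do ?exact: measurable_preimageT;
    apply: measurable_preimageT => //; exact: measurable_preimageT.
move=> mB; have [c1|c1] := eqVneq (1 + c)%R 0%R; last exact: (main c s B cs1 c1 mB).
have cE : (c = -1)%R by apply/eqP; rewrite -subr_eq0 opprK addrC c1.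
have sE : (s = 0)%R.
  by apply/eqP; rewrite -sqrf_eq0; move: cs1; rewrite cE sqrrN expr1n => /eqP;
    rewrite -subr_eq0 addrC addKr.
have E v : rotation c s v = rotation 0 1 (rotation 0 1 v).
  by rewrite /rotation cE sE /=; congr pair; ring.
have -> : rotation c s @^-1` B = rotation 0 1 @^-1` (rotation 0 1 @^-1` B).
  by apply/seteqP; split => v /=; rewrite E.
have q1 : (0 ^+ 2 + 1 ^+ 2 = 1 :> R)%R by rewrite expr0n expr1n add0r.
have q2 : (1 + 0 != 0 :> R)%R by rewrite addr0 oner_neq0.
by rewrite !main//; apply: measurable_preimageT => //; exact: measurable_rotation.
Qed.

End Shear.

Section Rotation.
Variables (R : realType) (c s : R).
Hypothesis cs1 : c ^+ 2 + s ^+ 2 = 1.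
Implicit Types (v w : plane R) (K D : set (mplane R)).

Local Notation rot := (rotation c s : plane R -> plane R).
Local Notation rot' := (rotation c (- s) : plane R -> plane R).

Lemma rotationK : cancel rot rot'.
Proof.
move=> v; rewrite /rotation /= ?opprK [RHS]surjective_pairing.
by congr pair; rewrite -[RHS]mul1r -cs1; ring.
Qed.

Lemma rotationVK : cancel rot' rot.
Proof.
move=> v; rewrite /rotation /= ?opprK [RHS]surjective_pairing.
by congr pair; rewrite -[RHS]mul1r -cs1; ring.
Qed.

Lemma enorm_rotation v w : enorm (rot v - rot w) = enorm (v - w).
Proof.
congr Num.sqrt; rewrite /rotation /=.
transitivity ((c ^+ 2 + s ^+ 2) * ((v.1 - w.1) ^+ 2 + (v.2 - w.2) ^+ 2)); first by ring.
by rewrite cs1 mul1r.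
Qed.

Lemma continuous_rotation : continuous rot.
Proof.
have lin p q (v : plane R) : (p * w.1 + q * w.2 : R) @[w --> v] --> p * v.1 + q * v.2.
  by apply: cvgD; apply: cvgM;
    [exact: cvg_cst|exact: cvg_fst|exact: cvg_cst|exact: cvg_snd].
by move=> v; exact: (cvg_pair (lin c s v) (lin (- s) c v)).
Qed.

End Rotation.

Section RotationInvariance.
Variables (R : realType) (c s : R).
Hypothesis cs1 : c ^+ 2 + s ^+ 2 = 1.
Implicit Types (v w : plane R) (K D : set (mplane R)).

Local Notation rot := (rotation c s : plane R -> plane R).
Local Notation rot' := (rotation c (- s) : plane R -> plane R).

Let cs1' : c ^+ 2 + (- s) ^+ 2 = 1. Proof. by rewrite sqrrN. Qed.

Lemma preimage_rotation (A : set (plane R)) : rot @^-1` A = rot' @` A.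
Proof.
apply/seteqP; split => v /=; first by exists (rot v) => //; exact: rotationK.
by move=> [w Aw <-]; rewrite rotationVK.
Qed.

Lemma hausdorff1_rotation (A : set (plane R)) :
  hausdorff1 (rot @^-1` A) = hausdorff1 A.
Proof.
apply/eqP; rewrite eq_le; apply/andP; split.
  rewrite preimage_rotation; apply: hausdorff1_lipschitz => v w.
  by rewrite (enorm_rotation cs1').
have {1}-> : A = rot @` (rot @^-1` A).
  apply/seteqP; split => v; last by move=> [w Aw <-].
  by exists (rot' v) => /=; rewrite rotationVK.
by apply: hausdorff1_lipschitz => v w; rewrite (enorm_rotation cs1).
Qed.

Lemma compact_rotation (K : set (plane R)) : compact K -> compact (rot @^-1` K).
Proof.
rewrite preimage_rotation => cK; apply: continuous_compact => //.
exact/continuous_subspaceT/continuous_rotation.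
Qed.

Lemma plane_convex_rotation (K : set (plane R)) :
  plane_convex K -> plane_convex (rot @^-1` K).
Proof.
move=> xK v w t Kv Kw t01; have := xK _ _ _ Kv Kw t01.
rewrite /preimage/= /rotation/=; congr K; congr pair; ring.
Qed.

Lemma interior_rotation (K : set (plane R)) : (rot @^-1` K)° = rot @^-1` K°.
Proof.
apply/seteqP; split => v; rewrite /interior /=.
  move=> Kv; have Kv' : nbhs (rot' (rot v)) (rot @^-1` K) by rewrite rotationK.
  have := @continuous_rotation R c (- s) (rot v) _ Kv'.
  apply: (@filterS _ (nbhs (rot v)) _ (rot' @^-1` (rot @^-1` K))).
  by move=> w /=; rewrite rotationVK.
by move=> Kv; exact: (@continuous_rotation R c s v K Kv).
Qed.

Lemma boundary_rotation (K : set (plane R)) : compact K ->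
  boundary (rot @^-1` K) = rot @^-1` boundary K.
Proof.
move=> cK; rewrite /boundary interior_rotation.
have /closure_id <- := compact_plane_closed cK.
by have /closure_id <- := compact_plane_closed (compact_rotation cK).
Qed.

End RotationInvariance.

Section CenterRotation.
Variables (R : realType) (c s M : R) (mu : {measure set (mplane R) -> \bar R}).
Hypothesis cs1 : c ^+ 2 + s ^+ 2 = 1.
Hypothesis mu_rotation : forall B, measurable B ->
  mu (rotation c (- s) @^-1` B) = mu B.
Variable D : set (mplane R).
Hypotheses (mD : measurable D) (muD : (mu D < +oo)%E).
Hypothesis bD : forall v, D v -> `|v.1 : R| <= M /\ `|v.2 : R| <= M.

Let mlin p q : measurable_fun setT (fun v : mplane R => p * v.1 + q * v.2 : R).
Proof. by apply: measurable_funD; apply: measurable_funM. Qed.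

Let ilin p q : mu.-integrable D (EFin \o (fun v : mplane R => p * v.1 + q * v.2 : R)).
Proof.
apply: measurable_bounded_integrable => //; first exact: measurable_funTS.
exists (`|p| * M + `|q| * M); split; first exact: num_real.
move=> N MN v /= /bD[v1 v2]; apply: le_trans (ltW MN).
by apply: le_trans (ler_normD _ _) _; rewrite !normrM lerD// ler_wpM2l.
Qed.

(** A change of variables, followed by linearity of the integral. *)
Lemma center_of_mass_rotation :
  (center_of_mass mu (rotation c (- s) @^-1` D)).1 =
  c * (center_of_mass mu D).1 + s * (center_of_mass mu D).2.
Proof.
rewrite /center_of_mass /= mu_rotation//.
have E : (\int[mu]_(x in rotation c (- s) @^-1` D) (x.1 : R)%:E =
    \int[mu]_(y in D) (c * y.1 + s * y.2)%:E)%E.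
  pose f (y : mplane R) : \bar R := (c * y.1 + s * y.2)%:E.
  have mrot := @measurable_rotation R c (- s).
  have fE v : f (rotation c (- s) v) = (v.1 : R)%:E.
    by have /(congr1 fst) /= h := @rotationVK R c s cs1 v; rewrite /f /= -[in RHS]h.
  transitivity (\int[pushforward mu (rotation c (- s))]_(y in D) f y)%E; last first.
    by apply: eq_measure_integral => A mA AD; exact: mu_rotation.
  rewrite [RHS](integral_pushforward mrot)//.
  - by apply: eq_integral => v _ /=; rewrite fE.
  - exact/measurable_EFinP.
  - rewrite (_ : f \o _ = EFin \o (fun v : mplane R => v.1 : R)); last first.
      by apply/funext => v /=; rewrite fE.
    apply: measurable_bounded_integrable.
    + by rewrite -[X in measurable X]setTI; exact: mrot.
    + by rewrite mu_rotation.
    + by apply: measurable_funTS; exact: measurable_fst.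
    + exists (`|c| * M + `|s| * M); split; first exact: num_real.
      move=> N MN v /= /bD[v1 v2]; apply: le_trans (ltW MN).
      have /(congr1 fst) /= h := @rotationVK R c s cs1 v; rewrite -h.
      by apply: le_trans (ler_normD _ _) _; rewrite !normrM lerD// ler_wpM2l.
rewrite {}E; have i1 := ilin 1 0; have i2 := ilin 0 1.
have e1 : (fun v : mplane R => 1 * v.1 + 0 * v.2 : R) = fun v => v.1.
  by apply/funext => v; ring.
have e2 : (fun v : mplane R => 0 * v.1 + 1 * v.2 : R) = fun v => v.2.
  by apply/funext => v; ring.
rewrite e1 in i1; rewrite e2 in i2.
have := @RintegralD _ _ _ mu D (fun v => c * v.1) (fun v => s * v.2) mD.
rewrite !RintegralZl// /Rintegral => ->; first by ring.
- have := ilin c 0; congr (_.-integrable _ (EFin \o _)).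
  by apply/funext => v; ring.
- have := ilin 0 s; congr (_.-integrable _ (EFin \o _)).
  by apply/funext => v; ring.
Qed.

End CenterRotation.

(** * The inequalities for a convex body *)

Section Centers.
Variable R : realType.
Implicit Types (v w : plane R) (K : set (plane R)).

Lemma compact_plane_bounded K : compact K ->
  exists M : R, forall v, K v -> `|v.1| <= M /\ `|v.2| <= M.
Proof.
move=> cK; have [K0|/set0P K0] := eqVneq K set0; first by exists 0 => v; rewrite K0.
have bnd (f : plane R -> R) : continuous f -> exists M, forall v, K v -> `|f v| <= M.
  move=> cf; have [|v _ h] := @compact_plane_min R (fun v => - `|f v|) K K0 cK.
    by move=> v; apply: cvgN; apply: cvg_norm; exact: cf.
  by exists `|f v| => w /h; rewrite lerN2.
have [M1 h1] := bnd _ (@continuous_fst_plane R).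
have [M2 h2] := bnd _ (@continuous_snd_plane R).
exists (Num.max M1 M2) => v Kv; rewrite !le_max.
by rewrite (h1 v Kv) (h2 v Kv) orbT.
Qed.

Lemma diameter_ge K v w : compact K -> K v -> K w -> enorm (v - w) <= diameter K.
Proof.
move=> cK Kv Kw; rewrite -lee_fin /diameter fineK.
  exact: enorm_le_ediameter.
have [M hM] := compact_plane_bounded cK.
have M0 : 0 <= M by apply: le_trans (hM v Kv).1; exact: normr_ge0.
rewrite ge0_fin_numE ?ediameter_ge0//.
apply: (@le_lt_trans _ _ (4 * M)%:E); last exact: ltry.
apply: ediameter_le; first by rewrite lee_fin mulr_ge0.
move=> {Kv Kw}v {}w /hM[v1 v2] /hM[w1 w2]; rewrite lee_fin enorm_le ?mulr_ge0//=.
have sq (x y : R) : `|x| <= M -> `|y| <= M -> (x - y) ^+ 2 <= (2 * M) ^+ 2.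
  move=> xM yM; rewrite -(real_normK (num_real (x - y))) ler_pXn2r ?nnegrE ?mulr_ge0//.
  by apply: le_trans (ler_normB _ _) _; lra.
apply: le_trans (lerD (sq _ _ v1 w1) (sq _ _ v2 w2)) _.
by rewrite !exprMn; have := sqr_ge0 M; lra.
Qed.

Section Body.
Variable K : set (plane R).
Hypotheses (cK : compact K) (xK : plane_convex K) (K0 : K° !=set0).

Let rotated (c s : R) : set (plane R) := (rotation c (- s) : plane R -> plane R) @^-1` K.

Let body_facts : [/\ measurable (K : set (mplane R)),
  measurable (boundary K : set (mplane R)),
  hausdorff1 (boundary K) \is a fin_num, boundary K `<=` K &
  (@area R K < +oo)%E].
Proof.
have [a [b [al [be [ab [cal cbe] [xal xbe] [le1 lt1] [KE bE _ _]]]]]] :=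
  convex_body_region cK xK K0.
split.
- by rewrite KE; exact: measurable_region.
- by rewrite bE; exact: measurable_frame.
- by rewrite bE; exact: hausdorff1_frame_fin.
- by rewrite bE => v [rv _]; rewrite KE.
- by rewrite KE area_region// ltry.
Qed.

Let rotated_facts (c s : R) : c ^+ 2 + s ^+ 2 = 1 ->
  [/\ compact (rotated c s), plane_convex (rotated c s), (rotated c s)° !=set0 &
  boundary (rotated c s) = (rotation c (- s) : plane R -> plane R) @^-1` boundary K].
Proof.
move=> cs1; have cs1' : c ^+ 2 + (- s) ^+ 2 = 1 by rewrite sqrrN.
split.
- exact: compact_rotation.
- exact: plane_convex_rotation.
- have [v Kv] := K0; rewrite interior_rotation//.
  by exists (rotation c s v) => /=; rewrite rotationK.
- exact: boundary_rotation.
Qed.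

(** Rotating the direction [(c, s)] to the horizontal. *)
Let centers_dot_le (c s : R) : c ^+ 2 + s ^+ 2 = 1 ->
  c * ((center_of_mass (@hausdorff1 R) (boundary K)).1 - (center_of_mass (@area R) K).1) +
  s * ((center_of_mass (@hausdorff1 R) (boundary K)).2 - (center_of_mass (@area R) K).2)
    <= diameter K / 6.
Proof.
move=> cs1; have cs1' : c ^+ 2 + (- s) ^+ 2 = 1 by rewrite sqrrN.
have [mK mb Hb sub Kf] := body_facts.
have [cK' xK' K0' bE'] := rotated_facts cs1.
have [M hM] := compact_plane_bounded cK.
have [a [b [al [be [ab [cal cbe] [xal xbe] [le1 lt1] [KE bE [va Kva va1] [vb Kvb vb1]]]]]]] :=
  convex_body_region cK' xK' K0'.
have h : (center_of_mass (@hausdorff1 R) (boundary (rotated c s))).1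
    - (center_of_mass (@area R) (rotated c s)).1 <= (b - a) / 6.
  by rewrite bE KE; exact: centers_fst_le.
have E1 : (center_of_mass (@hausdorff1 R) (boundary (rotated c s))).1 =
    c * (center_of_mass (@hausdorff1 R) (boundary K)).1 +
    s * (center_of_mass (@hausdorff1 R) (boundary K)).2.
  rewrite bE'.
  apply: (@center_of_mass_rotation R c s M (@borel_hausdorff1 R) cs1 _ (boundary K)) => //.
  - by move=> B mB; exact: hausdorff1_rotation.
  - by rewrite -ge0_fin_numE ?measure_ge0.
  - by move=> v /sub /hM.
have E2 : (center_of_mass (@area R) (rotated c s)).1 =
    c * (center_of_mass (@area R) K).1 + s * (center_of_mass (@area R) K).2.
  apply: (@center_of_mass_rotation R c s M (@lebesgue_measure R \x @lebesgue_measure R)%E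
    cs1 _ K) => //.
  by move=> B mB; exact: area_rotation.
have ba : b - a <= diameter K.
  rewrite -va1 -vb1; apply: le_trans (diameter_ge cK Kvb Kva).
  rewrite (enorm_rotation cs1').
  by apply: le_trans (ler_fst_enorm (vb - va)); exact: ler_norm.
have transfer (x y x' y' r : R) : x = x' -> y = y' -> x - y <= r -> x' - y' <= r.
  by move=> -> ->.
have {}h := transfer _ _ _ _ _ E1 E2 h.
move: h; move: (center_of_mass _ _) (center_of_mass _ _) => cH cA h.
by move: h ba; lra.
Qed.

Lemma enorm_centers_le :
  enorm (center_of_mass (@hausdorff1 R) (boundary K) - center_of_mass (@area R) K)
    <= diameter K / 6.
Proof.
have := centers_dot_le.
set cH := center_of_mass _ _; set cA := center_of_mass _ _.
move: cH cA => cH cA dot; pose d := cH - cA; rewrite -/d.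
have [d0|dn0] := eqVneq (enorm d) 0.
  have [v Kv] := K0; rewrite d0 divr_ge0//.
  apply: le_trans (diameter_ge cK (interior_subset Kv) (interior_subset Kv)).
  exact: enorm_ge0.
have u1 : (d.1 / enorm d) ^+ 2 + (d.2 / enorm d) ^+ 2 = 1.
  by rewrite !exprMn -mulrDl -sqr_enorm -exprMn divff// expr1n.
apply: le_trans (dot _ _ u1); rewrite le_eqVlt; apply/orP; left; apply/eqP.
rewrite -[LHS](mulfK dn0) -expr2 sqr_enorm -[cH.1 - cA.1]/(d.1) -[cH.2 - cA.2]/(d.2).
by field.
Qed.

(** A chord, made horizontal, is covered by the projections of the two boundary
    arcs. *)
Lemma diameter_le_perimeter : 2 * diameter K <= perimeter K.
Proof.
have [mK mb Hb sub Kf] := body_facts.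
rewrite mulrC -ler_pdivlMr// -lee_fin /diameter.
have P0 : 0 <= perimeter K / 2 by rewrite divr_ge0// fine_ge0// hausdorff1_ge0.
have dP : (ediameter K <= (perimeter K / 2)%:E)%E.
  apply: ediameter_le; first by rewrite lee_fin.
  move=> v w Kv Kw; rewrite lee_fin.
  pose d := v - w; rewrite -/d; have [->|dn0] := eqVneq (enorm d) 0 => //.
  pose c := d.1 / enorm d; pose s := d.2 / enorm d.
  have cs1 : c ^+ 2 + s ^+ 2 = 1.
    by rewrite !exprMn -mulrDl -sqr_enorm -exprMn divff// expr1n.
  have [cK' xK' K0' bE'] := rotated_facts cs1.
  have [a [b [al [be [ab [cal cbe] [xal xbe] [le1 lt1] [KE bE _ _]]]]]] :=
    convex_body_region cK' xK' K0'.
  have := hausdorff1_frame_ge cal cbe le1 lt1.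
  rewrite -bE bE' hausdorff1_rotation ?sqrrN// -(fineK Hb) lee_fin => h.
  have inr x : K x -> a <= c * x.1 + s * x.2 <= b.
    move=> Kx; have : rotated c s (rotation c s x) by rewrite /rotated/= rotationK.
    by rewrite KE => -[].
  have /andP[_ vb] := inr v Kv; have /andP[aw _] := inr w Kw.
  have -> : enorm d = c * d.1 + s * d.2.
    by rewrite -[LHS](mulfK dn0) -expr2 sqr_enorm /c /s; field.
  rewrite ler_pdivlMr//; apply: le_trans h.
  by rewrite /d /=; move: vb aw; lra.
rewrite fineK//; rewrite ge0_fin_numE ?ediameter_ge0//.
by apply: le_lt_trans dP _; exact: ltry.
Qed.

End Body.
End Centers.

Theorem mainTheorem2 (R : realType) (Omega : set (plane R))
    (Omega_compact : compact Omega)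
    (Omega_convex : convex_set (Omega : set (convex_lmodType (plane R))))
    (Omega_interior : Omega° !=set0) :
  enorm (center_of_mass (@hausdorff1 R) (boundary Omega)
         - center_of_mass (@area R) Omega)
    <= 1 / 6 * diameter Omega
    <= 1 / 12 * perimeter Omega.
Proof.
have xO := convex_set_plane Omega_convex.
have h1 := enorm_centers_le Omega_compact xO Omega_interior.
have h2 := diameter_le_perimeter Omega_compact xO Omega_interior.
by apply/andP; split; lra.
Qed.
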